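(* Let $n,k\geq 1$ be integers with $k\leq n$, let $1\leq p\leq\frac{n}{k}$, $1\leq q\leq\infty$, and define $\bar p\in[1,\infty]$ by $\frac{1}{\bar{p}}=\frac{1}{p}-\frac{k}{n}$ (so $\bar p=\infty$ when $p=n/k$). Suppose that either (i) $k<n$, and $(p,q)\in(1,\frac{n}{k}]\times[1,\infty]$ or $(p,q)=(1,1)$; or (ii) $k=n$ and $p=q=1$. Then there is a constant $c_{n,k}(p,q)$, depending only on $n,k,p,q$, such that $$\left\Vert f\right\Vert _{L(\bar{p},q)}\leq c_{n,k}(p,q)\left\Vert \,|D^{k}f|\,\right\Vert _{L(p,q)}\qquad\text{for all } f\in C_{0}^{\infty}(\mathbb{R}^{n}),$$ where $|D^{k}f|$ is the (Euclidean) length of the vector whose components are all the partial derivatives of $f$ of order $k$.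
   Context: $C_0^\infty(\mathbb{R}^n)$ is the space of smooth compactly supported functions on $\mathbb{R}^n$. For a measurable function $f$ on $\mathbb{R}^n$, $f^{\ast}$ denotes its decreasing rearrangement on $(0,\infty)$ (with respect to Lebesgue measure), i.e. $f^*(t)=\inf\{s\ge 0: |\{x:|f(x)|>s\}|\le t\}$, and $f^{\ast\ast}(t)=\frac1t\int_0^t f^{\ast}(s)\,ds$. For $1\leq q\leq\infty$ set $$\|f\|_{L(p,q)}=\left\{\int_0^\infty\left(f^{\ast}(t)t^{1/p}\right)^q\frac{dt}{t}\right\}^{1/q}\quad (1\leq p<\infty),$$ $$\|f\|_{L(\infty,q)}=\left\{\int_0^\infty\left(f^{\ast\ast}(t)-f^{\ast}(t)\right)^q\frac{dt}{t}\right\}^{1/q}\quad (p=\infty),$$ with the usual modification (supremum over $t>0$ of $f^*(t)t^{1/p}$, respectively of $f^{**}(t)-f^*(t)$) when $q=\infty$. These quantities are called norms but need not be norms. *)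

(* Defs.v *)
From HB Require Import structures.
From mathcomp Require Import all_boot all_order all_algebra.
From mathcomp Require Import all_classical all_reals all_analysis.

Set Implicit Arguments.
Unset Strict Implicit.
Unset Printing Implicit Defensive.

Import Order.TTheory GRing.Theory Num.Theory.
Import numFieldNormedType.Exports.

Local Open Scope classical_set_scope.
Local Open Scope ring_scope.

Section cons_measure.
Local Open Scope ereal_scope.
Context d (T : measurableType d) (R : realType) (n : nat).
Variables (mu : {sigma_finite_measure set T -> \bar R})
  (nu : {sigma_finite_measure set (n.-tuple T) -> \bar R}).

Let cons_pair (z : T * n.-tuple T) : n.+1.-tuple T := [tuple of z.1 :: z.2].

Let uncons (x : n.+1.-tuple T) : T * n.-tuple T :=
  (thead x, [tuple of behead x]).

Let cons_pairK : cancel cons_pair uncons.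
Proof. by move=> [x t]; congr pair; exact: val_inj. Qed.

Let measurable_cons_pair : measurable_fun setT cons_pair.
Proof. exact: measurable_cons. Qed.

Let measurable_uncons : measurable_fun setT uncons.
Proof.
apply/measurable_fun_pairP; split; last exact: measurable_behead.
exact: (measurable_tnth ord0).
Qed.

(* The product measure [mu \x nu], carried to [n.+1.-tuple T]. *)
Definition cons_measure : set (n.+1.-tuple T) -> \bar R :=
  pushforward (mu \x nu) cons_pair.

Let cons_measure0 : cons_measure set0 = 0.
Proof. by rewrite /cons_measure /pushforward preimage_set0 measure0. Qed.

Let cons_measure_ge0 A : 0 <= cons_measure A.
Proof. exact: measure_ge0. Qed.

Let cons_measure_sigma_additive : semi_sigma_additive cons_measure.
Proof.
move=> F mF tF mUF; rewrite /cons_measure /pushforward preimage_bigcup.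
apply: measure_semi_sigma_additive.
- by move=> i; rewrite -[X in measurable X]setTI; exact: measurable_cons_pair.
- apply/trivIsetP => i j _ _ ij; rewrite -preimage_setI.
  by move/trivIsetP : tF => /(_ _ _ _ _ ij) ->//; rewrite preimage_set0.
- rewrite -preimage_bigcup -[X in measurable X]setTI.
  exact: measurable_cons_pair.
Qed.

HB.instance Definition _ := isMeasure.Build _ _ _ cons_measure
  cons_measure0 cons_measure_ge0 cons_measure_sigma_additive.

Let cons_measure_sigma_finite : sigma_finite setT cons_measure.
Proof.
have /sigma_finiteP[F [FT ndF Foo]] := sigma_finiteT mu.
have /sigma_finiteP[G [GT ndG Goo]] := sigma_finiteT nu.
exists (fun i => uncons @^-1` (F i `*` G i)).
  rewrite -preimage_bigcup (_ : \bigcup_i _ = setT) ?preimage_setT//.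
  rewrite -setXTT FT GT; apply/seteqP; split => -[x y] /=.
    by move=> [i _ []]; split; exists i.
  move=> [[i _ Fx] [j _ Gy]]; exists (maxn i j) => //; split => /=.
  - by move: x Fx; exact/subsetPset/ndF/leq_maxl.
  - by move: y Gy; exact/subsetPset/ndG/leq_maxr.
move=> i; have [mF Fi] := Foo i; have [mG Gi] := Goo i; split.
  rewrite -[X in measurable X]setTI; apply: measurable_uncons => //.
  exact: measurableX.
rewrite /cons_measure /pushforward (_ : _ @^-1` _ = F i `*` G i).
  by rewrite product_measure1E// lte_mul_pinfty// ge0_fin_numE.
by rewrite -comp_preimage (_ : uncons \o _ = id) ?preimage_id//; exact/funext.
Qed.

HB.instance Definition _ := Measure_isSigmaFinite.Build _ _ _ cons_measure
  cons_measure_sigma_finite.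

End cons_measure.

Section lebesgue_measure_rV.
Context (R : realType).
Local Open Scope ereal_scope.

Fixpoint lebesgue_measure_tuple n :
    {sigma_finite_measure set (n.-tuple (measurableTypeR R)) -> \bar R} :=
  match n with
  | 0 => \d_[tuple]
  | m.+1 => cons_measure (@lebesgue_measure R) (lebesgue_measure_tuple m)
  end.

(* Lebesgue measure on R^n; it is meaningful on Borel sets. *)
Definition lebesgue_measure_rV n (A : set 'rV[R]_n) : \bar R :=
  lebesgue_measure_tuple n [set t | A (\row_i tnth t i)].

Lemma lebesgue_measure_rV_box n (I : 'I_n -> set R) :
  (forall i, measurable (I i)) ->
  lebesgue_measure_rV [set x : 'rV[R]_n | forall i, I i (x ord0 i)] =
  \prod_(i < n) @lebesgue_measure R (I i).
Proof.
move=> mI; rewrite /lebesgue_measure_rV.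
transitivity (lebesgue_measure_tuple n
    [set t : n.-tuple _ | forall i, I i (tnth t i)]).
  congr (lebesgue_measure_tuple n _); apply/seteqP.
  by split => t /= h i; have := h i; rewrite mxE.
elim: n I mI => [|n IH] I mI.
  by rewrite big_ord0 /= diracE mem_set// => -[].
rewrite big_ord_recl -(IH (fun i => I (lift ord0 i))) //=.
rewrite /cons_measure /pushforward -product_measure1E; first last.
- rewrite (_ : [set t : n.-tuple _ | _] = \bigcap_(i in [set: 'I_n])
      ((@tnth _ (measurableTypeR R)) ^~ i @^-1` I (lift ord0 i))); last first.
    by apply/seteqP; split => [t h i _|t h i]; [exact: h|exact: (h i)].
  apply: fin_bigcap_measurable => [|i _]; first exact: finite_finset.
  rewrite -[X in measurable X]setTI.
  by apply: (@measurable_tnth _ (measurableTypeR R)) => //; exact: mI.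
- exact: mI.
congr (_ _); apply/seteqP; split => -[x t] /=.
  by move=> h; split=> [|i]; [exact: (h ord0)|have := h (lift ord0 i); rewrite tnthS].
move=> [h0 h] i; case: (unliftP ord0 i) => [j ->|->//].
by rewrite tnthS; exact: h.
Qed.

End lebesgue_measure_rV.

Section lorentz.
Context (R : realType) (T : Type) (mu : set T -> \bar R).
Local Open Scope ereal_scope.
Implicit Types (f : T -> R) (p q : \bar R).

Definition rearrangement f (t : R) : \bar R :=
  ereal_inf [set s%:E | s in [set s : R | (0 <= s)%R /\
    mu [set x | (s < `|f x|)%R] <= t%:E]].

Definition maximal_rearrangement f (t : R) : \bar R :=
  t^-1%:E * \int[@lebesgue_measure R]_(s in `]0%R, t[) rearrangement f s.

(* The value at [q = -oo] is irrelevant. *)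
Definition norm_dtt q (g : R -> \bar R) : \bar R :=
  match q with
  | r%:E => poweR (\int[@lebesgue_measure R]_(t in `]0%R, +oo[)
                     (poweR (g t) r * t^-1%:E)) r^-1
  | +oo => ereal_sup [set g t | t in `]0%R, +oo[]
  | -oo => 0
  end.

(* [f^** - f^*] is the difference in [\bar R], where [+oo - +oo = -oo]; the
   case does not arise when [rearrangement f t] is finite for [t > 0], e.g. for
   bounded [f]. The value at [p = -oo] is irrelevant. *)
Definition lorentz_norm p q f : \bar R :=
  match p with
  | r%:E => norm_dtt q (fun t => rearrangement f t * (t `^ r^-1)%:E)
  | +oo => norm_dtt q (fun t => maximal_rearrangement f t - rearrangement f t)
  | -oo => 0
  end.

End lorentz.

Section derivatives.
Context (R : realType) (n : nat).
Implicit Types f : 'rV[R]_n -> R.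

Definition partial (i : 'I_n) f : 'rV[R]_n -> R := 'D_(delta_mx 0 i) f.

(* [partials [:: i1; ...; im] f] is d_{i1} (... (d_{im} f)). *)
Definition partials (s : seq 'I_n) f : 'rV[R]_n -> R := foldr partial f s.

Definition smooth f := forall s : seq 'I_n,
  continuous (partials s f) /\
  forall (i : 'I_n) (x : 'rV[R]_n), derivable (partials s f) x (delta_mx 0 i).

Definition compactly_supported f := compact (closure [set x | f x != 0]).

Definition multi_partial k (a : {ffun 'I_n -> 'I_k.+1}) f : 'rV[R]_n -> R :=
  partials (flatten [seq nseq (a i) i | i <- enum 'I_n]) f.

(* |D^k f|, with one component D^a f for each multi-index a of order k. *)
Definition norm_Dk k f (x : 'rV[R]_n) : R :=
  Num.sqrt (\sum_(a : {ffun 'I_n -> 'I_k.+1} | (\sum_i a i == k)%N)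
    multi_partial a f x ^+ 2).

End derivatives.

(* Main.v *)
(* Let E be the set where |f| > lam.  A cube Q of measure 2|E| has at least half
   of its translation vectors moving a given point out of E, and translating a
   truncation of f by h in Q costs at most diam(Q) |grad f| in L^1; averaging
   over h gives, for lam < Lam,
     (Lam - lam) |{|f| >= Lam}| <= C |{|f| > lam}|^{1/n} int_{lam<|f|<Lam} |grad f|.
   With lam and Lam consecutive values of f^* at the points t = t0 / 2^i, this is
     t (f^*(t/2) - f^*(t)) <= C t^{1/n} a_i,
   where a_i is the integral of |grad f| on a shell of measure at most t.  If
   p > 1, a_i is at most t |grad f|^**(t) and Hardy's inequality applies; if
   p = q = 1, the shells are disjoint and the a_i sum up to at most |grad f|_1.
   Summing the drops of f^* upwards bounds f^*, and summing them downwards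
   bounds f^** - f^*.  In terms of sequences indexed by i, each of these
   summations is a recursion z_{i+1} <= th z_i + w_i, or
   z_i <= th z_{i+1} + w_i, with th < 1, and convexity of x^q then bounds the
   l^q norm of z by that of w.  Higher orders follow by iteration, the
   intermediate exponents being larger than 1. *)

Require Import Defs.
From HB Require Import structures.
From mathcomp Require Import all_boot all_order all_algebra.
From mathcomp Require Import all_classical all_reals all_analysis.
From mathcomp Require Import measurable_realfun.
From mathcomp Require Import ring lra.

Set Implicit Arguments.
Unset Strict Implicit.
Unset Printing Implicit Defensive.

Import Order.TTheory GRing.Theory Num.Theory.
Import numFieldNormedType.Exports.

Local Open Scope classical_set_scope.
Local Open Scope ring_scope.

(** * Lebesgue measure on tuples *)

(** A truncated function is not differentiable, so its translates are controlled along coordinate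
    lines, by the fundamental theorem of calculus applied to f itself on a single crossing of the
    shell. The ratio th of the recursions has three origins. For the averages of the gradient it is
    2^(1/p-1), below 1 exactly when p > 1. For f^* it is 2^(-s) with s = 1/p - 1/n, below 1 exactly
    when the target exponent is finite. For f^** - f^* it is 1/2 whatever p is, since it comes only
    from averaging over an interval twice as long; this is why the oscillation is still controlled
    when s = 0. Compact support enters the estimates only qualitatively. Boundedness of f and of its
    gradient makes the recursions z_i <= th z_{i+1} + w_i end in 0, and a support of finite measure
    makes the other one start from 0 once t0 is large. Neither bound reaches the constant. The
    sequence estimates hold for every large t0 with the same bound, and the full norms on the
    half-line are recovered by letting t0 grow. *)

Section translation.
Context (R : realType).
Local Open Scope ereal_scope.
Local Notation T n := (n.-tuple (measurableTypeR R)).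
Local Notation mu := (@lebesgue_measure_tuple R _).

(** The translated measure gives half-open intervals their length, and this determines Lebesgue
    measure. *)
Lemma lebesgue_measure_translate (h : R) (A : set (measurableTypeR R)) :
  measurable A -> lebesgue_measure [set x | A (x + h)%R] = lebesgue_measure A.
Proof.
move=> mA; pose f : measurableTypeR R -> measurableTypeR R := fun x => (x + h)%R.
have mf : measurable_fun setT f by exact: measurable_funD.
pose nu : {measure set _ -> \bar R} := pushforward (@lebesgue_measure R) f.
suff H X : ocitv X -> lebesgue_measure X = nu mf X.
  by apply/esym; exact: (@lebesgue_measure_unique _ (nu mf) H A mA).
move=> /ocitvP[->|[[a b] /= ab ->]]; first by rewrite !measure0.
rewrite /nu /= /pushforward.
rewrite (_ : _ @^-1` _ = `](a - h)%R, (b - h)%R]%classic); last first.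
  by apply/seteqP; split => x /=; rewrite !in_itv/= /f ltrBlDr lerBrDr.
rewrite !lebesgue_measure_itv/= !lte_fin ltrD2r; case: ifP => // _.
by rewrite -!EFinB opprB addrA subrK.
Qed.

Lemma ge0_integral_translate (h : R) (f : measurableTypeR R -> \bar R) :
  measurable_fun setT f -> (forall x, 0 <= f x) ->
  \int[lebesgue_measure]_x f (x + h)%R = \int[lebesgue_measure]_x f x.
Proof.
move=> mf f0; pose g : measurableTypeR R -> measurableTypeR R := fun x => (x + h)%R.
have mg : measurable_fun setT g by exact: measurable_funD.
rewrite [LHS](_ : _ = \int[lebesgue_measure]_(x in g @^-1` setT) (f \o g) x)//.
rewrite -(@ge0_integral_pushforward _ _ _ _ _ _ mg)//.
apply: (@eq_measure_integral _ _ _ _ lebesgue_measure (pushforward lebesgue_measure g)) => A mA _.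
by rewrite /pushforward -[RHS](lebesgue_measure_translate h).
Qed.

Definition tadd n (x h : T n) : T n := [tuple (tnth x i + tnth h i)%R | i < n].

Lemma measurable_taddD n d (X : measurableType d) (f g : X -> T n) :
  measurable_fun setT f -> measurable_fun setT g ->
  measurable_fun setT (fun x => tadd (f x) (g x)).
Proof.
move=> /measurable_fun_tnthP mf /measurable_fun_tnthP mg.
apply/measurable_fun_tnthP => i.
rewrite (_ : _ \o _ = (fun x => tnth (f x) i + tnth (g x) i)%R).
  by apply: measurable_funD; [exact: mf|exact: mg].
by apply/funext => x /=; rewrite tnth_mktuple.
Qed.

Lemma measurable_tadd n (h : T n) : measurable_fun setT (fun x => tadd x h).
Proof. by apply: measurable_taddD. Qed.

Lemma tadd_cons n (x : R) (t : T n) (h : T n.+1) :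
  tadd [tuple of x :: t] h =
  [tuple of (x + thead h)%R :: tadd t [tuple of behead h]].
Proof.
apply/eq_from_tnth => i; rewrite tnth_mktuple.
case: (unliftP ord0 i) => [j ->|->]; rewrite ?tnthS ?tnth0 //=.
by rewrite tnth_mktuple tnth_behead; rewrite (_ : lift _ _ = inord j.+1)//;
  apply/val_inj; rewrite /= inordK// ltnS.
Qed.

(** By induction on the dimension: the measure is an integral over the first coordinate of the
    measures of sections. The induction hypothesis translates the sections, and the one-dimensional
    case translates the remaining integral. *)
Lemma lebesgue_measure_tuple_translate n (h : T n) (A : set (T n)) :
  measurable A -> mu [set x | A (tadd x h)] = mu A.
Proof.
elim: n h A => [|n IH] h A mA.
  by rewrite /= !diracE; congr ((nat_of_bool _)%:R%:E); apply/idP/idP;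
    rewrite !inE /= (tuple0 (tadd _ _)).
rewrite /= /cons_measure /pushforward /= /product_measure1 /=.
pose psi (x : measurableTypeR R) := mu [set t : T n | A [tuple of x :: t]].
have mc : measurable_fun setT
    (fun z : measurableTypeR R * T n => [tuple of z.1 :: z.2]).
  by apply: measurable_cons.
pose B := [set z : measurableTypeR R * T n | A [tuple of z.1 :: z.2]].
have mB : measurable B.
  by rewrite -[X in measurable X]setTI; exact: mc.
transitivity (\int[@lebesgue_measure R]_x psi (x + thead h)%R).
  apply: eq_integral => x _; rewrite /psi /=.
  rewrite -[RHS](IH [tuple of behead h]).
    congr (lebesgue_measure_tuple R n _); apply/seteqP; split => t;
    by rewrite /xsection /B /= inE /= tadd_cons.
  rewrite (_ : [set _ | _] = xsection B
      (x + thead h)%R); first exact: measurable_xsection.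
  by apply/seteqP; split => t; rewrite /xsection /B /= inE.
rewrite ge0_integral_translate//.
  apply: eq_integral => x _; rewrite /psi; congr (lebesgue_measure_tuple R n _).
  by apply/seteqP; split => t; rewrite /xsection /B /= inE.
rewrite (_ : psi = mu \o xsection B).
  exact: measurable_fun_xsection.
apply/funext => x; rewrite /psi /=; congr (lebesgue_measure_tuple R n _).
by apply/seteqP; split => t; rewrite /xsection /B /= inE.
Qed.

Lemma ge0_integral_tuple_translate n (h : T n) (f : T n -> \bar R) :
  measurable_fun setT f -> (forall x, 0 <= f x) ->
  \int[mu]_x f (tadd x h) = \int[mu]_x f x.
Proof.
move=> mf f0; have mg := measurable_tadd h.
rewrite [LHS](_ : _ = \int[mu]_(x in (fun x => tadd x h) @^-1` setT)
  (f \o (fun x => tadd x h)) x)//.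
rewrite -(@ge0_integral_pushforward _ _ _ _ _ _ mg)//.
apply: (@eq_measure_integral _ _ _ _ mu (pushforward mu (fun x => tadd x h))) => A mA _.
by rewrite /pushforward -[RHS](lebesgue_measure_tuple_translate h).
Qed.

End translation.

(** * Boxes, open sets and continuous functions in the tuple model *)

Section measurability.
Context (R : realType).
Local Notation T n := (n.-tuple (measurableTypeR R)).
Local Notation mu := (@lebesgue_measure_tuple R _).

Definition row_of_tuple n (t : T n) : 'rV[R]_n := \row_i tnth t i.

Lemma measurable_tuple_box n (I : 'I_n -> set (measurableTypeR R)) :
  (forall i, measurable (I i)) ->
  measurable [set t : T n | forall i, I i (tnth t i)].
Proof.
move=> mI; rewrite (_ : [set t : T n | _] = \bigcap_(i in [set: 'I_n])
      ((@tnth _ (measurableTypeR R)) ^~ i @^-1` I i)); last first.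
  by apply/seteqP; split => [t h i _|t h i]; [exact: h|exact: (h i)].
apply: fin_bigcap_measurable => [|i _]; first exact: finite_finset.
rewrite -[X in measurable X]setTI.
by apply: (@measurable_tnth _ (measurableTypeR R)) => //; exact: mI.
Qed.

Lemma lebesgue_measure_tuple_box n (I : 'I_n -> set (measurableTypeR R)) :
  (forall i, measurable (I i)) ->
  mu [set t : T n | forall i, I i (tnth t i)] =
  (\prod_(i < n) lebesgue_measure (I i))%E.
Proof.
move=> mI; rewrite -(lebesgue_measure_rV_box mI) /lebesgue_measure_rV.
congr (lebesgue_measure_tuple R n _).
by apply/seteqP; split => t /= h i; have := h i; rewrite mxE.
Qed.

Lemma open_measurable_row n (U : set 'rV[R]_n) :
  open U -> measurable [set t : T n | U (row_of_tuple t)].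
Proof.
move=> oU.
pose box (c : {ffun 'I_n -> rat * rat}) := [set t : T n | forall i,
  `]ratr (c i).1, ratr (c i).2[%classic (tnth t i)].
(* A box that is not inside [U] is replaced by the empty set, so that the union runs over the
   countable type of all rational boxes. *)
pose F c := if pselect (box c `<=` [set t | U (row_of_tuple t)])
  then box c else set0.
rewrite (_ : [set t | _] = \bigcup_c F c).
  apply: countable_bigcupT_measurable => // c; rewrite /F.
  case: pselect => //= _.
  exact: (measurable_tuple_box (fun i => measurable_itv `]ratr (c i).1, ratr (c i).2[)).
apply/seteqP; split => [t /= Ut|t [c _]]; last first.
  by rewrite /F; case: pselect => //= h /h.
have /nbhs_ballP[e /= e0 he] : nbhs (row_of_tuple t) U by exact: open_nbhs_nbhs.
have H i : exists c : rat * rat,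
    [/\ tnth t i - e < ratr c.1, ratr c.1 < tnth t i,
        tnth t i < ratr c.2 & ratr c.2 < tnth t i + e].
  have [q] := @rat_in_itvoo R (tnth t i - e) (tnth t i) ltac:(lra).
  have [r] := @rat_in_itvoo R (tnth t i) (tnth t i + e) ltac:(lra).
  rewrite !in_itv /= => /andP[? ?] /andP[? ?].
  by exists (q, r).
have [c hc] := choice H.
exists (finfun c) => //; rewrite /F; case: pselect => /= [_ i|].
  by rewrite /= ffunE /= in_itv /=; have [_ -> -> _] := hc i.
case=> s /= hs; apply: he; split => // i j; rewrite !mxE.
have := hs j; rewrite /= ffunE /= in_itv /= => /andP[s1 s2].
have [h1 h2 h3 h4] := hc j.
by rewrite /ball /= ltr_norml; apply/andP; split; lra.
Qed.

Lemma continuous_measurable_row n (f : 'rV[R]_n -> R) :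
  continuous f -> measurable_fun setT (fun t : T n => f (row_of_tuple t)).
Proof.
move=> /continuousP cf.
apply: (measurability _ (RGenOpens.measurableE R)) => _ [_ [a [b ->] <-]].
rewrite setTI; apply: (@open_measurable_row _ (f @^-1` `]a, b[%classic)).
by apply: cf; exact: interval_open.
Qed.

End measurability.

(** * Level sets and gradients *)

Section truncation_on_a_line.
Context (R : realType).
Implicit Types (h phi : R -> R) (a b lam Lam : R).

(** [y] is the last point of [[a, b]] where [h <= alpha], and [z] the first point after [y] where
    [h >= beta]; compactness provides both. *)
Lemma crossing_subinterval h a b alpha beta :
  continuous h -> a <= b -> h a <= alpha -> beta <= h b -> alpha < beta ->
  exists y z, [/\ a <= y, y < z, z <= b, h y <= alpha &
    beta <= h z /\ forall s, s \in `]y, z[ -> alpha < h s < beta].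
Proof.
move=> ch ab ha hb alphabeta.
have cI (C : set R) u v : closed C -> compact (`[u, v]%classic `&` h @^-1` C).
  move=> cC; apply: compact_closedI; first exact: segment_compact.
  by move/continuous_closedP : ch; apply.
have cid (A : set R) : {within A, continuous (@idfun R)}.
  by apply: continuous_subspaceT => x; exact: cvg_id.
pose S := `[a, b]%classic `&` h @^-1` `]-oo, alpha]%classic.
have S0 : S !=set0 by exists a; split; rewrite /= in_itv /= ?lexx ?ab ?ha.
have cS : compact S by apply: cI; exact: lray_closed.
have [y yS ymax] := compact_EVT_max S0 cS (cid S).
move: yS; rewrite inE => -[]; rewrite /= !in_itv /= => /andP[ay yb] hy.
pose S' := `[y, b]%classic `&` h @^-1` `[beta, +oo[%classic.
have S'0 : S' !=set0 by exists b; split; rewrite /= in_itv /= ?lexx ?yb ?hb.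
have cS' : compact S' by apply: cI; exact: rray_closed.
have [z zS zmin] := compact_EVT_min S'0 cS' (cid S').
move: zS; rewrite inE => -[]; rewrite /= !in_itv /= andbT => /andP[yz zb] hz.
have {}yz : y < z.
  rewrite lt_neqAle yz andbT; apply/eqP => yzE; move: hz; rewrite -yzE => hz.
  by have := le_lt_trans (le_trans hz hy) alphabeta; rewrite ltxx.
exists y, z; split => //; split => // s; rewrite in_itv /= => /andP[ys sz].
apply/andP; split; rewrite ltNge; apply/negP => hs.
  have := ymax s; rewrite inE /S /= !in_itv /= hs (le_trans ay (ltW ys)).
  by rewrite (le_trans (ltW sz) zb) leNgt ys => /(_ (conj isT isT)).
have := zmin s; rewrite inE /S' /= !in_itv /= hs (ltW ys).
by rewrite (le_trans (ltW sz) zb) leNgt sz => /(_ (conj isT isT)).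
Qed.

Lemma crossing_subinterval_sym h a b alpha beta :
  continuous h -> a <= b -> alpha < beta ->
  (h a <= alpha /\ beta <= h b) \/ (h b <= alpha /\ beta <= h a) ->
  exists y z, [/\ a <= y, y < z, z <= b, beta - alpha <= `|h z - h y| &
    forall s, s \in `]y, z[ -> alpha < h s < beta].
Proof.
move=> ch ab alphabeta [[ha hb]|[hb ha]].
  have [y [z [ay yz zb hy [hz H]]]] := crossing_subinterval ch ab ha hb alphabeta.
  by exists y, z; split => //; rewrite (le_trans _ (ler_norm _))//; lra.
(* The descending case is the ascending one for the reflected function. *)
pose g s := h (- s).
have cg : continuous g.
  by move=> s; apply: continuous_comp; [exact: opp_continuous|exact: ch].
have ba : - b <= - a by rewrite lerN2.
have gb : g (- b) <= alpha by rewrite /g opprK.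
have ga : beta <= g (- a) by rewrite /g opprK.
have [y [z [ay yz zb hy [hz H]]]] := crossing_subinterval cg ba gb ga alphabeta.
exists (- z), (- y); split; rewrite ?ltrN2 //; [lra|lra| |].
  by rewrite distrC (le_trans _ (ler_norm _))//; rewrite /g in hy hz; lra.
move=> s; rewrite in_itv /= => /andP[s1 s2].
have := H (- s); rewrite /g opprK; apply; rewrite in_itv /=.
by apply/andP; split; lra.
Qed.

(** Composed with f, this truncation of |f| is constant where |f| <= lam and where |f| >= Lam, so
    only the gradient on the shell between contributes to its variation. *)
Definition clamp lam Lam (y : R) : R := Num.max lam (Num.min `|y| Lam).

Lemma measurable_clamp lam Lam : measurable_fun setT (clamp lam Lam).
Proof.
rewrite /clamp; apply: measurable_maxr => //; exact: measurable_minr.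
Qed.

Lemma FTC_norm_le phi y z : y < z ->
  (forall s, derivable phi s 1) -> continuous (derive1 phi) ->
  (`|phi z - phi y|%:E <=
    \int[lebesgue_measure]_(s in `]y, z[) `|(derive1 phi) s|%:E)%E.
Proof.
move=> yz dphi cphi'.
have cphi : continuous phi.
  by move=> x; apply/differentiable_continuous/derivable1_diffP.
have ic : {within `[y, z], continuous (derive1 phi)} by exact: continuous_subspaceT.
have dp : derivable_oo_LRcontinuous phi y z.
  split; [by move=> x _|exact/cvg_at_right_filter/cphi|exact/cvg_at_left_filter/cphi].
have := @continuous_FTC2 R _ phi y z yz ic dp (fun x _ => erefl).
move=> FTC.
rewrite -[X in (X <= _)%E]/(`|(phi z - phi y)%:E|)%E EFinB -FTC.
apply: (le_trans (le_abse_integral _ _ _)) => //.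
  by apply/measurable_EFinP; exact: subspace_continuous_measurable_fun.
rewrite integral_itv_bndo_bndc ?integral_itv_obnd_cbnd//=.
  apply: measurable_funS (measurableT) _ _ => //.
  apply/measurable_EFinP; apply: measurableT_comp => //.
  exact: continuous_measurable_fun.
apply: measurable_funS (measurableT) _ _ => //.
apply/measurable_EFinP; apply: measurableT_comp => //.
exact: continuous_measurable_fun.
Qed.

(** The fundamental theorem is applied to [phi], not to its truncation, on a subinterval where |phi|
    stays inside the shell; there the restricted integrand is the full derivative. *)
Lemma clamp_variation phi a b lam Lam : a <= b -> lam <= Lam ->
  (forall s, derivable phi s 1) -> continuous (derive1 phi) ->
  (`|clamp lam Lam (phi b) - clamp lam Lam (phi a)|%:E <=
   \int[lebesgue_measure]_(s in `[a, b])
     ((fun s => `|(derive1 phi) s|%:E) \_ [set s | lam < `|phi s| < Lam]%R) s)%E.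
Proof.
move=> ab lL dphi cphi'.
have cphi : continuous phi.
  by move=> x; apply/differentiable_continuous/derivable1_diffP.
pose T := clamp lam Lam; pose h s := `|phi s|.
pose A := [set s | lam < `|phi s| < Lam]%R.
have ch : continuous h.
  by move=> s; apply: continuous_comp; [exact: cphi|exact: norm_continuous].
have TE u v : T (phi u) < T (phi v) ->
    [/\ lam <= T (phi u), T (phi v) <= Lam, h u <= T (phi u) & T (phi v) <= h v].
  rewrite /T /clamp -/(h u) -/(h v) !maxEle !minEle.
  by do !case: ifP => //; move=> *; split; lra.
(* [alpha] and [beta] are the smaller and the larger truncated end value; one crossing from one to
   the other accounts for their whole difference. *)
suff main alpha beta : lam <= alpha -> beta <= Lam -> alpha < beta ->
    (h a <= alpha /\ beta <= h b) \/ (h b <= alpha /\ beta <= h a) ->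
    ((beta - alpha)%:E <= \int[lebesgue_measure]_(s in `[a, b])
     ((fun s => `|(derive1 phi) s|%:E) \_ A) s)%E.
  have [TT|TT|TT] := ltgtP (T (phi a)) (T (phi b)).
  - have [l1 l2 l3 l4] := TE _ _ TT.
    by rewrite gtr0_norm ?subr_gt0//; apply: main => //; left.
  - have [l1 l2 l3 l4] := TE _ _ TT.
    by rewrite distrC gtr0_norm ?subr_gt0//; apply: main => //; right.
  - rewrite -/T TT subrr normr0; apply: integral_ge0 => s _.
    by apply: erestrict_ge0.
move=> la bL alphabeta hab.
have [y [z [ay yz zb hyz H]]] := crossing_subinterval_sym ch ab alphabeta hab.
have mphi' : measurable_fun setT (fun s => `|(derive1 phi) s|%:E).
  apply/measurable_EFinP; apply: measurableT_comp => //.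
  exact: continuous_measurable_fun.
have mA : measurable A.
  have mh := continuous_measurable_fun ch.
  rewrite (_ : A = h @^-1` `]lam, Lam[%classic); last first.
    by apply/seteqP; split => s /=; rewrite in_itv.
  by rewrite -[X in measurable X]setTI; exact: mh.
have mw : measurable_fun setT ((fun s => `|(derive1 phi) s|%:E) \_ A).
  by apply/(measurable_restrictT _ mA); exact: measurable_funTS.
apply: (@le_trans _ _ `|phi z - phi y|%:E).
  rewrite lee_fin (le_trans hyz)// /h.
  exact: ler_dist_dist.
apply: (le_trans (FTC_norm_le yz dphi cphi')).
apply: (@le_trans _ _ (\int[lebesgue_measure]_(s in `]y, z[)
     ((fun s => `|(derive1 phi) s|%:E) \_ A) s)%E).
  rewrite le_eqVlt; apply/orP; left; apply/eqP; apply: eq_integral => s.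
  rewrite inE /= => /H /andP[s1 s2]; rewrite patchE ifT// inE /A /=.
  by rewrite (le_lt_trans la s1) (lt_le_trans s2 bL).
apply: ge0_subset_integral => //=.
- exact: measurable_funS mw.
- by move=> s _; apply: erestrict_ge0.
- move=> s /=; rewrite !in_itv /= => /andP[s1 s2].
  by rewrite (le_trans ay (ltW s1)) (le_trans (ltW s2) zb).
Qed.

End truncation_on_a_line.

(** * Translates of the truncation and the level set estimate *)

Section gradient_truncation.
Context (R : realType) (n : nat).
Local Notation T := (n.-tuple (measurableTypeR R)).
Local Notation mu := (@lebesgue_measure_tuple R n).
Implicit Types (f : 'rV[R]_n -> R) (lam Lam : R).

Definition tdelta (i : 'I_n) (s : R) : T := [tuple if j == i then s else 0 | j < n].

Lemma row_tadd_tdelta (t : T) i s :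
  row_of_tuple (tadd t (tdelta i s)) = s *: delta_mx 0 i + row_of_tuple t.
Proof.
apply/rowP => j; rewrite !mxE !tnth_mktuple eqxx /=.
by case: eqP => _; rewrite ?mulr1 ?mulr0 addrC.
Qed.

Definition C1_rV f := continuous f /\ forall i : 'I_n,
  (forall x, derivable f x (delta_mx 0 i)) /\ continuous (partial i f).

Lemma derive_line f (x : 'rV[R]_n) i s :
  derivable f (s *: delta_mx 0 i + x) (delta_mx 0 i) ->
  derivable (fun s : R => f (s *: delta_mx 0 i + x)) s 1 /\
  derive1 (fun s : R => f (s *: delta_mx 0 i + x)) s =
    partial i f (s *: delta_mx 0 i + x).
Proof.
move=> df.
have E : (fun h : R => h^-1 *: ((fun s : R => f (s *: delta_mx 0 i + x)) (h *: 1 + s) -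
     (fun s : R => f (s *: delta_mx 0 i + x)) s)) =
   (fun h => h^-1 *: (f (h *: delta_mx 0 i + (s *: delta_mx 0 i + x)) -
      f (s *: delta_mx 0 i + x))).
  by apply/funext => h /=; rewrite [h *: 1]mulr1 scalerDl addrA.
split; first by rewrite /derivable /= E.
by rewrite derive1E /partial /derive /= E.
Qed.

Definition truncated_partial f lam Lam i (t : T) : \bar R :=
  ((fun t => `|partial i f (row_of_tuple t)|%:E)
     \_ [set t | lam < `|f (row_of_tuple t)| < Lam]) t.

Section fixed_function.
Variables (f : 'rV[R]_n -> R) (lam Lam : R).
Hypotheses (C1f : C1_rV f) (lL : lam <= Lam).
Let Tf t := clamp lam Lam (f (row_of_tuple t)).
Let w := truncated_partial f lam Lam.
Local Open Scope ereal_scope.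

Lemma measurable_row : measurable_fun setT (fun t : T => f (row_of_tuple t)).
Proof. by apply: continuous_measurable_row; case: C1f. Qed.

Lemma measurable_level_set (a b : R) :
  measurable [set t : T | a < `|f (row_of_tuple t)| < b]%R.
Proof.
have m : measurable_fun setT (fun t : T => `|f (row_of_tuple t)|)%R.
  by apply: measurableT_comp => //; exact: measurable_row.
rewrite (_ : [set t | _] = (fun t : T => `|f (row_of_tuple t)|%R) @^-1` `]a, b[%classic).
  by rewrite -[X in measurable X]setTI; exact: m.
by apply/seteqP; split => s /=; rewrite in_itv.
Qed.

Lemma measurable_truncated_partial i : measurable_fun setT (w i).
Proof.
apply/(measurable_restrictT _ (measurable_level_set _ _)).
apply: measurable_funTS; apply/measurable_EFinP; apply: measurableT_comp => //.
by apply: continuous_measurable_row; case: C1f => _ /(_ i)[].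
Qed.

Lemma truncated_partial_ge0 i t : 0 <= w i t.
Proof. by rewrite /w /truncated_partial patchE; case: ifP => // _; rewrite lee_fin. Qed.

Lemma measurable_Tf : measurable_fun setT Tf.
Proof. by apply: measurableT_comp; [exact: measurable_clamp|exact: measurable_row]. Qed.

Lemma measurable_Tf_diff (g : T -> T) : measurable_fun setT g ->
  measurable_fun setT (fun t => `|Tf (g t) - Tf t|%:E).
Proof.
move=> mg; apply/measurable_EFinP; apply: measurableT_comp => //.
apply: measurable_funB; last exact: measurable_Tf.
by apply: measurableT_comp => //; exact: measurable_Tf.
Qed.

(** [clamp_variation] is integrated over all segments in direction [i]. After exchanging the
    integrals, translation invariance makes the inner one independent of the position on the
    segment, whose length gives the factor [s]. *)
Lemma translate_tdelta i (s : R) : (0 <= s)%R ->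
  \int[mu]_t `|Tf (tadd t (tdelta i s)) - Tf t|%:E <= s%:E * \int[mu]_t w i t.
Proof.
move=> s0; pose F (z : T * measurableTypeR R) := w i (tadd z.1 (tdelta i z.2)).
have mtd : measurable_fun setT (fun s : measurableTypeR R => tdelta i s).
  apply/measurable_fun_tnthP => j; rewrite (_ : _ \o _ =
    fun s => if j == i then s else 0%R).
    by case: (j == i).
  by apply/funext => u /=; rewrite tnth_mktuple.
have mF : measurable_fun setT F.
  apply: measurableT_comp; first exact: measurable_truncated_partial.
  by apply: measurable_taddD => //; exact: measurableT_comp.
have F0 z : 0 <= F z by exact: truncated_partial_ge0.
(* Extension by 0 off the segment lets Tonelli's theorem be used on the full product space. *)
pose F' := F \_ (setT `*` `[0%R, s]%classic).
have mF' : measurable_fun setT F'.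
  have mD : measurable ([set: T] `*` `[0%R, s]%classic : set (T * measurableTypeR R)).
    by apply: measurableX => //; exact: measurable_itv.
  by apply/(measurable_restrictT _ mD); exact: measurable_funTS.
have F'0 z : 0 <= F' z by exact: erestrict_ge0.
have line t : \int[lebesgue_measure]_u F' (t, u) =
    \int[lebesgue_measure]_(u in `[0%R, s]) F (t, u).
  rewrite [RHS]integral_mkcond; apply: eq_integral => u _; rewrite /F' !patchE.
  by congr (if _ then _ else _); apply/idP/idP; rewrite !inE /= => // -[].
apply: (@le_trans _ _ (\int[mu]_t \int[lebesgue_measure]_u F' (t, u))).
  apply: ge0_le_integral => //.
  - exact: (measurable_Tf_diff (measurable_tadd (tdelta i s))).
  - exact: (measurable_fun_fubini_tonelli_F (m2 := @lebesgue_measure R) F' mF' F'0).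
  move=> t _; rewrite line.
  pose phi u := f (u *: delta_mx 0 i + row_of_tuple t)%R.
  have [cf /(_ i)[df cpf]] := C1f.
  have dphi u : derivable phi u 1.
    by have [] := derive_line (df (u *: delta_mx 0 i + row_of_tuple t)%R).
  have phi'E : derive1 phi = fun u => partial i f (u *: delta_mx 0 i + row_of_tuple t)%R.
    by apply/funext => u; have [_ ->] := derive_line (df (u *: delta_mx 0 i + row_of_tuple t)%R).
  have cphi' : continuous (derive1 phi).
    rewrite phi'E => u; apply: cvg_comp; last exact: cpf.
    apply: cvgD; last exact: cvg_cst.
    by apply: cvgZr_tmp; exact: cvg_id.
  have := clamp_variation s0 lL dphi cphi'.
  rewrite /phi scale0r add0r -row_tadd_tdelta -/(Tf _) -/(Tf _).
  move/le_trans; apply; rewrite le_eqVlt; apply/orP; left; apply/eqP.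
  apply: eq_integral => u _.
  rewrite /F /w /truncated_partial !patchE /= -/phi phi'E.
  rewrite row_tadd_tdelta; congr (if _ then _ else _).
  by apply/idP/idP; rewrite !inE /= row_tadd_tdelta.
rewrite (fubini_tonelli (m1 := mu) (m2 := @lebesgue_measure R) F')//.
rewrite [leLHS](_ : _ = \int[lebesgue_measure]_(u in `[0%R, s]) \int[mu]_t w i t); last first.
  rewrite [RHS]integral_mkcond; apply: eq_integral => u _; rewrite patchE.
  case: ifPn => us.
    rewrite -[RHS](ge0_integral_tuple_translate (tdelta i u)) //.
    - apply: eq_integral => t _; rewrite /F' patchE ifT// inE; split => //=.
      by move: us; rewrite inE.
    - exact: measurable_truncated_partial.
    - exact: truncated_partial_ge0.
  apply: integral0_eq => t _; rewrite /F' patchE ifF//; apply/negbTE.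
  by apply: contra us; rewrite !inE => -[].
rewrite integral_cst//= lebesgue_measure_itv/= lte_fin.
by case: ltP => [_|s0']; rewrite ?sube0 ?mule0 muleC// (_ : s = 0%R) ?mule0//; lra.
Qed.

(** Corners of a path from 0 to [h] along the coordinate axes, for translating one coordinate at a
    time. *)
Definition tcut (k : nat) (h : T) : T :=
  [tuple if (j < k)%N then tnth h j else 0%R | j < n].

Lemma tcutS (k : 'I_n) h :
  tadd (tcut k h) (tdelta k (tnth h k)) = tcut k.+1 h.
Proof.
apply/eq_from_tnth => j; rewrite !tnth_mktuple ltnS.
have [->|jk] := eqVneq j k; first by rewrite ltnn leqnn add0r.
by rewrite addr0 [in RHS]leq_eqVlt (negbTE (jk : (j : nat) != k)).
Qed.

Lemma taddA (x y z : T) : tadd x (tadd y z) = tadd (tadd x y) z.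
Proof. by apply/eq_from_tnth => j; rewrite !tnth_mktuple addrA. Qed.

Lemma taddC (x y : T) : tadd x y = tadd y x.
Proof. by apply/eq_from_tnth => j; rewrite !tnth_mktuple addrC. Qed.

(** Each leg of the axis path costs at most [r] times the integral of one partial derivative:
    translation invariance removes the shift accumulated on the previous legs. *)
Lemma translate_tuple (h : T) (r : R) : (forall i, 0 <= tnth h i <= r)%R ->
  \int[mu]_t `|Tf (tadd t h) - Tf t|%:E <= r%:E * \sum_(i < n) \int[mu]_t w i t.
Proof.
move=> hr.
have w0 i : 0 <= \int[mu]_t w i t.
  by apply: integral_ge0 => t _; exact: truncated_partial_ge0.
suff H k : (k <= n)%N -> \int[mu]_t `|Tf (tadd t (tcut k h)) - Tf t|%:E <=
    r%:E * \sum_(i < n | (i < k)%N) \int[mu]_t w i t.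
  have := H n (leqnn n); rewrite (_ : tcut n h = h); last first.
    by apply/eq_from_tnth => j; rewrite tnth_mktuple ltn_ord.
  by under eq_bigl do rewrite ltn_ord.
elim: k => [_|k IH kn].
  rewrite big_pred0// mule0 (_ : (fun t => _) = cst 0) ?integral0//.
  apply/funext => t /=; rewrite (_ : tadd t _ = t) ?subrr ?normr0//.
  by apply/eq_from_tnth => j; rewrite !tnth_mktuple ltn0 addr0.
pose ko := Ordinal kn.
have r0 : (0 <= r)%R by have /andP[] := hr ko; exact: le_trans.
have -> : \sum_(i < n | (i < k.+1)%N) \int[mu]_t w i t =
    \int[mu]_t w ko t + \sum_(i < n | (i < k)%N) \int[mu]_t w i t.
  rewrite (bigD1 ko)//=; congr (_ + _); apply: eq_bigl => i.
  by rewrite ltnS [RHS]ltn_neqAle andbC.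
rewrite ge0_muleDr//; last exact: sume_ge0.
have mk := measurable_tadd (tcut k h).
have m1 := measurable_Tf_diff (measurable_tadd (tdelta ko (tnth h ko))).
pose D t := `|Tf (tadd t (tdelta ko (tnth h ko))) - Tf t|%:E.
have D0 t : 0 <= D t by rewrite lee_fin.
(* Triangle inequality through the translate by [tcut k h]; the first term is the one-coordinate
   difference [D] read at the shifted point. *)
apply: (@le_trans _ _ (\int[mu]_t (D (tadd t (tcut k h)) +
    `|Tf (tadd t (tcut k h)) - Tf t|%:E))).
  apply: ge0_le_integral => //.
  - by apply: measurable_Tf_diff; exact: measurable_tadd.
  - apply: emeasurable_funD; last exact: measurable_Tf_diff.
    exact: (measurableT_comp (m1 : measurable_fun setT D)).
  - move=> t _; rewrite /D -EFinD lee_fin -taddA (tcutS ko).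
    by rewrite -[in leLHS](subrK (Tf (tadd t (tcut k h))) (Tf _)) -addrA ler_normD.
rewrite ge0_integralD//; last 2 first.
- exact: (measurableT_comp (m1 : measurable_fun setT D)).
- exact: measurable_Tf_diff.
apply: leeD; last by apply: IH; exact: ltnW.
rewrite (ge0_integral_tuple_translate (tcut k h) (m1 : measurable_fun setT D))//.
have /andP[h0 hr'] := hr ko.
apply: (le_trans (translate_tdelta ko h0)).
by apply: lee_wpmul2r; rewrite ?lee_fin.
Qed.

(** Chebyshev's inequality: on this set the truncation is [Lam] at [t] and at most [lam], hence
    equal to [lam], at [t + h]. *)
Lemma sublevel_translate (h : T) :
  (Lam - lam)%:E * mu [set t | (Lam <= `|f (row_of_tuple t)|)%R /\
     (`|f (row_of_tuple (tadd t h))| <= lam)%R] <=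
  \int[mu]_t `|Tf (tadd t h) - Tf t|%:E.
Proof.
set A := [set t | _].
have m : measurable_fun setT (fun t : T => `|f (row_of_tuple t)|)%R.
  by apply: measurableT_comp => //; exact: measurable_row.
have mA : measurable A.
  rewrite (_ : A = (fun t : T => `|f (row_of_tuple t)|%R) @^-1` `[Lam, +oo[%classic
    `&` (fun t : T => `|f (row_of_tuple (tadd t h))|%R) @^-1` `]-oo, lam]%classic).
    apply: measurableI; rewrite -[X in measurable X]setTI; first exact: m.
    have mh : measurable_fun setT (fun t : T => `|f (row_of_tuple (tadd t h))|%R).
      exact: (measurableT_comp m (measurable_tadd h)).
    exact: mh.
  by apply/seteqP; split => t /=; rewrite !in_itv /= andbT.
rewrite -integral_cst// integral_mkcond.
apply: ge0_le_integral => //.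
- by move=> t _; apply: erestrict_ge0 => u _; rewrite lee_fin subr_ge0.
- by apply/(measurable_restrictT _ mA).
- by apply: measurable_Tf_diff; exact: measurable_tadd.
move=> t _; rewrite patchE; case: ifPn => [|_]; last by rewrite lee_fin.
rewrite inE => -[h1 h2]; rewrite lee_fin /Tf /clamp.
have -> : Num.min `|f (row_of_tuple t)|%R Lam = Lam by apply/min_idPr.
have -> : Num.max lam Lam = Lam by apply/max_idPr.
rewrite (_ : Num.max lam _ = lam); last first.
  by apply/max_idPl; rewrite ge_min h2.
by rewrite distrC ler_norm.
Qed.

(** The measure of the set [Z] of pairs is estimated in two orders. Integrating over [h] first gives
    at least half the cube for each [t] in [G]; integrating over [t] first, the translation estimate
    applies for each [h] in the cube. In [2 * r], the 2 undoes that half and [r] is the side of the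
    cube. *)
Lemma level_set_estimate (r : R) : (0 < r)%R ->
  2%:E * mu [set t | (lam < `|f (row_of_tuple t)|)%R] <= (r ^+ n)%:E ->
  (Lam - lam)%:E * mu [set t | (Lam <= `|f (row_of_tuple t)|)%R] <=
  (2 * r)%:E * \sum_(i < n) \int[mu]_t w i t.
Proof.
set E := [set t | _]; set G := [set t | _] => r0 Er.
have rn0 : (0 < r ^+ n)%R by exact: exprn_gt0.
have m : measurable_fun setT (fun t : T => `|f (row_of_tuple t)|)%R.
  by apply: measurableT_comp => //; exact: measurable_row.
have mE : measurable E.
  rewrite (_ : E = (fun t : T => `|f (row_of_tuple t)|%R) @^-1` `]lam, +oo[%classic).
    by rewrite -[X in measurable X]setTI; exact: m.
  by apply/seteqP; split => t /=; rewrite in_itv /= andbT.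
have mG : measurable G.
  rewrite (_ : G = (fun t : T => `|f (row_of_tuple t)|%R) @^-1` `[Lam, +oo[%classic).
    by rewrite -[X in measurable X]setTI; exact: m.
  by apply/seteqP; split => t /=; rewrite in_itv /= andbT.
pose B := [set h : T | forall i, `[0%R, r]%classic (tnth h i)].
have mB : measurable B.
  exact: (measurable_tuple_box (fun i => measurable_itv `[0%R, r])).
have muB : mu B = (r ^+ n)%:E.
  rewrite /B (lebesgue_measure_tuple_box (fun i => measurable_itv `[0%R, r])).
  rewrite (eq_bigr (fun=> r%:E)); last first.
    by move=> i _; rewrite lebesgue_measure_itv /= lte_fin r0 sube0.
  by rewrite prodEFin prodr_const card_ord.
pose Z := [set z : T * T | G z.1 /\ B z.2 /\ ~ E (tadd z.1 z.2)].
have mZ : measurable Z.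
  have mf1 : measurable_fun setT (fst : T * T -> T) by [].
  have mf2 : measurable_fun setT (snd : T * T -> T) by [].
  have mf3 : measurable_fun setT (fun z : T * T => tadd z.1 z.2).
    by apply: measurable_taddD.
  apply: measurableI; first by rewrite -[X in measurable X]setTI; exact: mf1.
  apply: measurableI; first by rewrite -[X in measurable X]setTI; exact: mf2.
  apply: measurableC; rewrite -[X in measurable X]setTI; exact: mf3.
(* The vectors moving [t] into [E] form a translate of [E], of measure at most [r ^ n / 2] by
   hypothesis. *)
have half t : G t -> (r ^+ n / 2)%:E <= \int[mu]_h (\1_Z (t, h))%:E.
  move=> Gt; pose S := [set h | B h /\ ~ E (tadd t h)].
  have mEt : measurable [set h | E (tadd t h)].
    rewrite -[X in measurable X]setTI.
    by apply: (_ : measurable_fun setT (fun h => tadd t h)); first exact: measurable_taddD.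
  have mS : measurable S by apply: measurableI => //; exact: measurableC.
  have muEt : mu [set h | E (tadd t h)] = mu E.
    rewrite -[RHS](lebesgue_measure_tuple_translate t)//; congr (lebesgue_measure_tuple R n _).
    by apply/seteqP; split => h /=; rewrite taddC.
  have BS : mu B <= mu E + mu S.
    rewrite -muEt; apply: (le_trans _ (measureU2 _ _ _)) => //.
    apply: le_measure; rewrite ?inE//; first exact: measurableU.
    by move=> h Bh; have [|] := pselect (E (tadd t h)); [left|right].
  rewrite (_ : (fun h => _) = (fun h => (\1_S h)%:E)); last first.
    apply/funext => h; rewrite !indicE; congr (_%:R%:E); congr nat_of_bool.
    by apply/idP/idP; rewrite !inE /= => // -[? []].
  rewrite integral_indic// setIT.
  have : (2%:E * mu B <= 2%:E * (mu E + mu S)) by rewrite lee_pmul2l.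
  rewrite ge0_muleDr// muB => H; have {}H := le_trans H (leeD2r _ Er).
  suff Hs (x : \bar R) : 0 <= x ->
      2%:E * (r ^+ n)%:E <= (r ^+ n)%:E + 2%:E * x -> (r ^+ n / 2)%:E <= x.
    exact: (Hs _ _ H).
  case: x => [s _|_ _|//]; last by rewrite leey.
  by rewrite -!EFinM -EFinD !lee_fin; lra.
have w0 i : 0 <= \int[mu]_t w i t.
  by apply: integral_ge0 => t _; exact: truncated_partial_ge0.
have L0 : 0 <= (Lam - lam)%:E by rewrite lee_fin subr_ge0.
set W := \sum_(i < n) _.
have W0 : 0 <= W by apply: sume_ge0.
have mZ1 : measurable_fun setT (fun z => (\1_Z z)%:E : \bar R).
  by apply/measurable_EFinP; exact: measurable_indic.
have Z0 z : 0 <= (\1_Z z)%:E :> \bar R by rewrite lee_fin.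
have lower : (r ^+ n / 2)%:E * mu G <= \int[mu]_h \int[mu]_t (\1_Z (t, h))%:E.
  rewrite -(fubini_tonelli (m1 := mu) (m2 := mu) (fun z => (\1_Z z)%:E))//.
  rewrite -integral_cst// integral_mkcond; apply: ge0_le_integral => //.
  - move=> t _; apply: erestrict_ge0 => u _; rewrite lee_fin divr_ge0//; exact: ltW.
  - by apply/(measurable_restrictT _ mG).
  - exact: (measurable_fun_fubini_tonelli_F (m2 := mu) (fun z => (\1_Z z)%:E)).
  move=> t _; rewrite patchE; case: ifPn => [|_]; last exact: integral_ge0.
  by rewrite inE; exact: half.
have upper : (Lam - lam)%:E * \int[mu]_h \int[mu]_t (\1_Z (t, h))%:E <=
    (r ^+ n)%:E * (r%:E * W).
  have mI := measurable_fun_fubini_tonelli_G (m1 := mu) (fun z => (\1_Z z)%:E) mZ1 Z0.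
  rewrite -ge0_integralZl//; last by move=> h _; exact: integral_ge0.
  rewrite -muB muleC -integral_cst// [leRHS]integral_mkcond.
  apply: ge0_le_integral => //.
  - by move=> h _; apply: mule_ge0 => //; exact: integral_ge0.
  - exact: measurable_funeM.
  - by apply/(measurable_restrictT _ mB).
  move=> h _; rewrite patchE; case: ifPn => [|nB].
    rewrite inE => Bh.
    apply: (le_trans _ (translate_tuple (h := h) (r := r) _)); last first.
      by move=> i; have := Bh i; rewrite /= in_itv.
    apply: (le_trans _ (sublevel_translate h)).
    rewrite (_ : [set t | _] = [set t | G t /\ ~ E (tadd t h)]); last first.
      apply/seteqP; split => t /= [Gt]; rewrite /E /= => Et; split => //.
        by apply/negP; rewrite -leNgt.
      by rewrite leNgt; apply/negP.
    rewrite (_ : (fun t => _) = (fun t => (\1_[set t | G t /\ ~ E (tadd t h)] t)%:E)).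
      rewrite integral_indic ?setIT//.
      have := measurable_ysection h mZ; congr measurable.
      by apply/seteqP; split => t; rewrite /ysection /= inE /= => -[? // []].
    apply/funext => t; rewrite !indicE; congr (_%:R%:E); congr nat_of_bool.
    by apply/idP/idP; rewrite !inE /= => -[? // []].
  rewrite (_ : (fun t => _) = cst 0) ?integral0 ?mule0//.
  apply/funext => t; rewrite indicE memNset//= => -[_ []].
  by move: nB; rewrite notin_setE.
have := le_trans (lee_wpmul2l L0 lower) upper.
rewrite [X in X <= _ -> _](_ : _ = (r ^+ n)%:E * (2^-1%:E * ((Lam - lam)%:E * mu G))); last first.
  by rewrite !muleA -!EFinM; congr (_%:E * _); field.
rewrite lee_pmul2l// => H.
have : 2%:E * (2^-1%:E * ((Lam - lam)%:E * mu G)) <= 2%:E * (r%:E * W) by rewrite lee_pmul2l.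
by rewrite !muleA -!EFinM divff// mul1r.
Qed.

End fixed_function.
End gradient_truncation.

(** * Sequences and dyadic discretization *)

Section sequence_bounds.
Context (R : realType).
Implicit Types (q : \bar R) (w z v : nat -> R) (X Y th : R).

(* [X] bounds the l^q norm of the nonnegative sequence [w]. *)
Definition lqb q w X : Prop := 0 <= X /\
  match q with
  | r%:E => forall m, \sum_(i < m) w i `^ r <= X `^ r
  | +oo%E => forall i, w i <= X
  | -oo%E => False
  end.

Lemma powR_mono (r x y : R) : 0 <= r -> 0 <= x -> x <= y -> x `^ r <= y `^ r.
Proof. by move=> r0 x0 xy; rewrite ge0_ler_powR// nnegrE// (le_trans x0). Qed.

Lemma powR_convex2 (r th x y : R) : 1 <= r -> 0 <= th <= 1 -> 0 <= x -> 0 <= y ->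
  (th * x + (1 - th) * y) `^ r <= th * x `^ r + (1 - th) * y `^ r.
Proof.
move=> r1 /andP[th0 th1] x0 y0.
have t01 : Itv.spec (@Itv.num_sem R) (Itv.Real `[0%Z, 1%Z]) th.
  by rewrite /Itv.spec /= /Itv.num_sem /= num_real !in_itv /= th0 th1.
have := @convex_powR R r r1 (Itv.mk t01) x y.
rewrite !inE /= !in_itv /= !andbT => /(_ x0 y0).
by rewrite !convRE.
Qed.

Lemma lqb_mono q w z X : (1 <= q)%E -> (forall i, 0 <= w i <= z i) -> lqb q z X -> lqb q w X.
Proof.
move=> + wz [X0]; case: q => [r| |]//; rewrite ?lee_fin => r1 H; split => //.
  move=> m; apply: (le_trans _ (H m)); apply: ler_sum => i _.
  by have /andP[? ?] := wz i; apply: powR_mono => //; lra.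
by move=> i; have /andP[_ /le_trans] := wz i; apply.
Qed.

Lemma lqb_le q w X Y : (1 <= q)%E -> X <= Y -> lqb q w X -> lqb q w Y.
Proof.
move=> + XY [X0]; case: q => [r| |]//; rewrite ?lee_fin => r1 H; (split; first lra).
  by move=> m; apply: (le_trans (H m)); apply: powR_mono => //; lra.
by move=> i; apply: (le_trans (H i)).
Qed.

Lemma lqb_scale q w X (c : R) : (1 <= q)%E -> (forall i, 0 <= w i) -> 0 <= c ->
  lqb q w X -> lqb q (fun i => c * w i) (c * X).
Proof.
move=> + w0 c0 [X0]; case: q => [r| |]//; rewrite ?lee_fin => r1 H;
  (split; first exact: mulr_ge0).
  move=> m; rewrite powRM//; under eq_bigr do rewrite powRM//.
  by rewrite -mulr_sumr ler_wpM2l ?powR_ge0.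
by move=> i; rewrite ler_wpM2l.
Qed.

Lemma lqb_shift q w X : lqb q w X -> lqb q (fun i => w i.+1) X.
Proof.
move=> [X0]; case: q => [r| |]// H; split => //.
move=> m; apply: (le_trans _ (H m.+1)).
by rewrite big_ord_recl /= ler_wpDl ?powR_ge0.
Qed.

(** The factor [1 - th] on the source makes the right side a convex combination, so the bound
    [Y ^ r] passes from each partial sum to the next without loss. Callers put the factor
    [1 / (1 - th)] into [v]. *)
Lemma lqb_forward q z v Y th : (1 <= q)%E -> 0 <= th < 1 ->
  (forall i, 0 <= z i) -> (forall i, 0 <= v i) -> z 0%N = 0 ->
  (forall i, z i.+1 <= th * z i + (1 - th) * v i) -> lqb q v Y -> lqb q z Y.
Proof.
move=> + /andP[th0 th1] z0 v0 z00 zS [Y0]; case: q => [r| |]//; rewrite ?lee_fin => r1 H;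
  split => //.
  have r0 : 0 < r by lra.
  have HS i : z i.+1 `^ r <= th * z i `^ r + (1 - th) * v i `^ r.
    apply: (le_trans (powR_mono (ltW r0) (z0 _) (zS i))).
    by apply: powR_convex2 => //; apply/andP; split; lra.
  elim=> [|m IH]; first by rewrite big_ord0 powR_ge0.
  have H1 : \sum_(i < m.+1) z i `^ r <=
      th * (\sum_(i < m) z i `^ r) + (1 - th) * (\sum_(i < m) v i `^ r).
    rewrite big_ord_recl /= z00 powR0 ?gt_eqF// add0r !mulr_sumr -big_split /=.
    by apply: ler_sum => i _; exact: HS.
  apply: (le_trans H1); have := H m; nra.
elim=> [|i IH]; first by rewrite z00.
by apply: (le_trans (zS i)); have := H i; nra.
Qed.

(** No initial value is known here; summing up to [m] leaves the boundary term [th * z m ^ r], which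
    the convergence to 0 removes. *)
Lemma lqb_backward q z v Y th : (1 <= q)%E -> 0 <= th < 1 ->
  (forall i, 0 <= z i) -> (forall i, 0 <= v i) -> z @ \oo --> 0 ->
  (forall i, z i <= th * z i.+1 + (1 - th) * v i) -> lqb q v Y -> lqb q z Y.
Proof.
move=> + /andP[th0 th1] z0 v0 zcvg zS [Y0].
have small e m : 0 < e -> exists2 m', (m <= m')%N & z m' <= e.
  move=> e0; move/cvgrPdist_le : zcvg => /(_ e e0)[N _ HN].
  exists (maxn N m); first exact: leq_maxr.
  have := HN (maxn N m) (leq_maxl _ _).
  by rewrite /= sub0r normrN ger0_norm.
case: q => [r| |]//; rewrite ?lee_fin => r1 H; split => //.
  have r0 : 0 < r by lra.
  have HS i : z i `^ r <= th * z i.+1 `^ r + (1 - th) * v i `^ r.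
    apply: (le_trans (powR_mono (ltW r0) (z0 _) (zS i))).
    by apply: powR_convex2 => //; apply/andP; split; lra.
  have H1 m : (1 - th) * (\sum_(i < m) z i `^ r) <=
      (1 - th) * Y `^ r + th * z m `^ r.
    have : \sum_(i < m) z i `^ r <=
        th * (\sum_(i < m) z i.+1 `^ r) + (1 - th) * (\sum_(i < m) v i `^ r).
      by rewrite !mulr_sumr -big_split; apply: ler_sum => i _; exact: HS.
    have : \sum_(i < m) z i.+1 `^ r <= \sum_(i < m) z i `^ r + z m `^ r.
      have <- : \sum_(i < m.+1) z i `^ r = \sum_(i < m) z i `^ r + z m `^ r.
        by rewrite big_ord_recr.
      by rewrite big_ord_recl /= lerDr powR_ge0.
    have := H m; nra.
  move=> m; apply/ler_addgt0Pr => e e0.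
  (* Being at most 1, [e'] satisfies [e' ^ r <= e'] since [r >= 1]; the factor [1 - th] is divided
     out at the end. *)
  pose e' := Num.min 1 ((1 - th) * e).
  have e'0 : 0 < e' by rewrite lt_min ltr01 mulr_gt0//; lra.
  have [m' mm' zm'] := small e' m e'0.
  have zr : z m' `^ r <= e'.
    apply: (le_trans (powR_mono (ltW r0) (z0 _) zm')).
    have e'1 : e' <= 1 by rewrite ge_min lexx.
    by apply: ge1r_powR => //; rewrite e'0.
  have e'e : e' <= (1 - th) * e by rewrite ge_min lexx orbT.
  have S : \sum_(i < m) z i `^ r <= \sum_(i < m') z i `^ r.
    rewrite -!(big_mkord xpredT (fun i => z i `^ r)) (big_cat_nat (leq0n m) mm')//=.
    by rewrite lerDl sumr_ge0// => i _; exact: powR_ge0.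
  apply: (le_trans S); rewrite -(ler_pM2l (_ : 0 < 1 - th)); last lra.
  by apply: (le_trans (H1 m')); have := powR_ge0 (z m') r; nra.
(* For [q = +oo] the recursion is iterated [k] times, and the remainder tends to 0. *)
have HY k : forall i, z i <= Y + z (i + k)%N.
  elim: k => [|k IH] i; first by rewrite addn0; lra.
  apply: (le_trans (zS i)); have := IH i.+1; rewrite addSnnS => ?.
  have := H i; have := z0 (i + k.+1)%N; nra.
move=> i; apply/ler_addgt0Pr => e e0.
have [m' im' zm'] := small e i e0.
apply: (le_trans (HY (m' - i)%N i)).
by rewrite subnKC//; lra.
Qed.

(** Instead of Minkowski's inequality, u + v is written as twice a midpoint and convexity is used,
    which costs the factor 2. *)
Lemma lqb_add q u v X Y : (1 <= q)%E ->
  (forall i, 0 <= u i) -> (forall i, 0 <= v i) ->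
  lqb q u X -> lqb q v Y -> lqb q (fun i => u i + v i) (2 * (X + Y)).
Proof.
move=> + u0 v0 [X0 +] [Y0]; case: q => [r| |]//; rewrite ?lee_fin => r1 HX HY;
  (split; first lra); last first.
  by move=> i; have := HX i; have := HY i; lra.
have r0 : 0 <= r by lra.
move=> m; rewrite powRM//; last lra.
have H i : (u i + v i) `^ r <= 2 `^ r * (2^-1 * u i `^ r + (1 - 2^-1) * v i `^ r).
  rewrite (_ : u i + v i = 2 * (2^-1 * u i + (1 - 2^-1) * v i)); last by field.
  have ui := u0 i; have vi := v0 i.
  rewrite powRM//; last by lra.
  rewrite ler_wpM2l ?powR_ge0// powR_convex2//.
  by apply/andP; split; lra.
apply: (@le_trans _ _ (\sum_(i < m) 2 `^ r * (2^-1 * u i `^ r + (1 - 2^-1) * v i `^ r))).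
  by apply: ler_sum => i _; exact: H.
rewrite -mulr_sumr ler_wpM2l ?powR_ge0// big_split /= -!mulr_sumr.
have := HX m; have := HY m.
have : X `^ r <= (X + Y) `^ r by apply: powR_mono => //; lra.
have : Y `^ r <= (X + Y) `^ r by apply: powR_mono => //; lra.
lra.
Qed.

Lemma lqb_sum q (I : Type) (s : seq I) (w : I -> nat -> R) (X : I -> R) : (1 <= q)%E ->
  (forall l i, 0 <= w l i) -> (forall l, lqb q (w l) (X l)) ->
  lqb q (fun i => \sum_(l <- s) w l i) (2 ^+ size s * \sum_(l <- s) X l).
Proof.
move=> q1 w0 H; elim: s => [|a s IH].
  rewrite big_nil mulr0; under eq_fun do rewrite big_nil.
  case: q q1 {H} => [r| |]//; rewrite ?lee_fin => r1; split => // m.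
  by rewrite big1// => i _; rewrite powR0// gt_eqF//; lra.
under eq_fun do rewrite big_cons.
rewrite big_cons exprS -mulrA.
have Xa0 : 0 <= X a by case: (H a).
have p1 : 1 <= 2 ^+ size s :> R by apply: exprn_ege1; lra.
apply: lqb_le (lqb_add q1 (w0 a) _ (H a) IH) => //.
  by rewrite ler_wpM2l// mulrDr lerD2r ler_peMl.
by move=> i; apply: sumr_ge0.
Qed.

End sequence_bounds.

Section dyadic.
Context (R : realType).
Implicit Types t : R.

Definition dyadic (t0 : R) (i : nat) : R := t0 / 2 ^+ i.

Lemma dyadicS (t0 : R) i : dyadic t0 i = 2 * dyadic t0 i.+1.
Proof. by rewrite /dyadic exprS; field; rewrite expf_neq0. Qed.

Lemma dyadic0 (t0 : R) : dyadic t0 0 = t0.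
Proof. by rewrite /dyadic expr0 divr1. Qed.

Lemma dyadic_gt0 (t0 : R) i : 0 < t0 -> 0 < dyadic t0 i.
Proof. by move=> t00; rewrite divr_gt0// exprn_gt0. Qed.

Lemma dyadic_nincr (t0 : R) i j : 0 < t0 -> (i <= j)%N -> dyadic t0 j <= dyadic t0 i.
Proof.
move=> t00 ij; rewrite ler_wpM2l ?(ltW t00)// lef_pV2 ?posrE ?exprn_gt0//.
by rewrite ler_eXn2l// ltr1n.
Qed.

Lemma dyadic_small (t0 e : R) : 0 < t0 -> 0 < e -> exists i, dyadic t0 i <= e.
Proof.
move=> t00 e0; have [N HN] : exists N : nat, t0 / e < N%:R.
  exists (Num.bound (t0 / e)); exact/archi_boundP/divr_ge0/ltW/e0/ltW.
exists N; rewrite /dyadic ler_pdivrMr ?exprn_gt0//.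
rewrite ltr_pdivrMr// in HN; rewrite mulrC; apply: (le_trans (ltW HN)).
rewrite ler_wpM2r ?(ltW e0)// -natrX ler_nat.
exact: ltnW (ltn_expl _ _).
Qed.

Lemma itv_dyadic_bigcup (t0 : R) : 0 < t0 ->
  `]0, t0[%classic = \bigcup_i `[dyadic t0 i.+1, dyadic t0 i[%classic.
Proof.
move=> t00; apply/seteqP; split => [t|t [i _]] /=; rewrite !in_itv /=; last first.
  move=> /andP[ti it]; rewrite (lt_le_trans _ ti) ?dyadic_gt0//=.
  by rewrite (lt_le_trans it)// -[leRHS](dyadic0 t0) dyadic_nincr.
move=> /andP[t1 t2].
have ex : exists i, dyadic t0 i <= t by exact: dyadic_small.
case: (ex_minnP ex) => -[|i] Hi Hmin; first by move: Hi; rewrite dyadic0 leNgt t2.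
exists i => //=; rewrite in_itv /= Hi /= ltNge; apply/negP => /Hmin.
by rewrite ltnn.
Qed.

Lemma trivIset_dyadic (t0 : R) : 0 < t0 ->
  trivIset setT (fun i => `[dyadic t0 i.+1, dyadic t0 i[%classic).
Proof.
move=> t00; apply/trivIsetP => i j _ _.
wlog ij : i j / (i < j)%N.
  move=> H; rewrite neq_ltn => /orP[ij|ji]; first by apply: H => //; rewrite ltn_eqF.
  by rewrite setIC; apply: H => //; rewrite ltn_eqF.
move=> _; apply/seteqP; split => t //= []; rewrite !in_itv /= => /andP[a b] /andP[c e].
have := lt_le_trans e (le_trans (dyadic_nincr t00 ij) a).
by rewrite ltxx.
Qed.

End dyadic.

(** * Norms with respect to dt/t against dyadic sequences *)

Section norm_dtt_discretization.
Context (R : realType).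
Variables (G : R -> R).
Hypotheses (mG : measurable_fun (`]0, +oo[%classic : set R) G) (G0 : forall t, 0 < t -> 0 <= G t).
Local Notation mu := (@lebesgue_measure R).

Let Phi (r t : R) : \bar R := (G t `^ r * t^-1)%:E.

Let Phi_ge0 r t : 0 < t -> (0 <= Phi r t)%E.
Proof. by move=> t0; rewrite lee_fin mulr_ge0 ?powR_ge0// invr_ge0 ltW. Qed.

Let measurable_Phi r : measurable_fun (`]0, +oo[%classic : set R) (Phi r).
Proof.
apply/measurable_EFinP; apply: measurable_funM.
  exact: (measurableT_comp (measurable_powR r)).
apply: subspace_continuous_measurable_fun => //.
apply: continuous_in_subspaceT => t; rewrite inE /= in_itv /= andbT => t0.
by apply: inv_continuous; rewrite gt_eqF.
Qed.

Let Phi_itv r (a b : R) : 0 < a -> a < b ->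
  measurable_fun (`[a, b[%classic : set R) (Phi r) /\ (forall t, t \in `[a, b[ -> 0 < t).
Proof.
move=> a0 ab; have H t : t \in `[a, b[ -> 0 < t.
  by rewrite in_itv /= => /andP[/(lt_le_trans a0)].
split=> //; apply: measurable_funS (@measurable_Phi r) => //.
by move=> t /= /H t0; rewrite in_itv /= t0.
Qed.

(** On an interval from a to 2a the weight 1/t lies between 1/(2a) and 1/a, so the mass of dt/t is
    at most 1, used here, and at least 1/2, used in [integral_dyadic_ge]. *)
Let integral_dyadic_le (r v t0 : R) i : 0 < t0 -> 0 <= r ->
  (forall t, dyadic t0 i.+1 <= t < dyadic t0 i -> G t <= v) ->
  (\int[mu]_(t in `[dyadic t0 i.+1, dyadic t0 i[) Phi r t <= (v `^ r)%:E)%E.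
Proof.
move=> t00 r0 H; set a := dyadic t0 i.+1; set b := dyadic t0 i.
have a0 : 0 < a by exact: dyadic_gt0.
have bE : b = 2 * a by rewrite /b dyadicS.
have ab : a < b by rewrite bE; lra.
have [mP tP] := Phi_itv r a0 ab.
have -> : v `^ r = v `^ r / a * (b - a) by rewrite bE; field; rewrite gt_eqF.
apply: (@le_trans _ _ (\int[mu]_(t in `[a, b[) (v `^ r / a)%:E)%E); last first.
  by rewrite integral_cst//= lebesgue_measure_itv/= lte_fin ab -EFinB -EFinM.
apply: ge0_le_integral => //.
- by move=> t /tP; exact: Phi_ge0.
move=> t tab; have t0' := tP _ tab.
move: (tab); rewrite /= in_itv /= => /[dup] tab' /andP[at' _].
rewrite lee_fin ler_pM ?powR_ge0// ?invr_ge0 ?(ltW t0')//.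
  by apply: powR_mono => //; [exact: G0|exact: H].
by rewrite lef_pV2 ?posrE.
Qed.

Let integral_dyadic_ge (r v t0 : R) i : 0 < t0 -> 0 <= r -> 0 <= v ->
  (forall t, dyadic t0 i.+1 <= t < dyadic t0 i -> v <= G t) ->
  ((v `^ r / 2)%:E <= \int[mu]_(t in `[dyadic t0 i.+1, dyadic t0 i[) Phi r t)%E.
Proof.
move=> t00 r0 v0 H; set a := dyadic t0 i.+1; set b := dyadic t0 i.
have a0 : 0 < a by exact: dyadic_gt0.
have bE : b = 2 * a by rewrite /b dyadicS.
have ab : a < b by rewrite bE; lra.
have b0 : 0 < b by exact: lt_trans ab.
have [mP tP] := Phi_itv r a0 ab.
have -> : v `^ r / 2 = v `^ r / b * (b - a) by rewrite bE; field; rewrite gt_eqF.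
apply: (@le_trans _ _ (\int[mu]_(t in `[a, b[) (v `^ r / b)%:E)%E).
  by rewrite integral_cst//= lebesgue_measure_itv/= lte_fin ab -EFinB -EFinM.
apply: ge0_le_integral => //.
- by move=> t _; rewrite lee_fin divr_ge0 ?powR_ge0 ?ltW.
move=> t tab; have t0' := tP _ tab.
move: (tab); rewrite /= in_itv /= => /[dup] tab' /andP[_ tb].
rewrite lee_fin ler_pM ?powR_ge0// ?invr_ge0 ?(ltW b0)//.
  by apply: powR_mono => //; exact: H.
by rewrite lef_pV2 ?posrE// ltW.
Qed.

Let integral_split r t0 : 0 < t0 ->
  (\int[mu]_(t in `]0%R, t0[) Phi r t =
  \sum_(i <oo) \int[mu]_(t in `[dyadic t0 i.+1, dyadic t0 i[) Phi r t)%E.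
Proof.
move=> t00; rewrite itv_dyadic_bigcup// ge0_integral_bigcup//.
- rewrite -itv_dyadic_bigcup//; apply: measurable_funS (@measurable_Phi r) => //.
  by move=> t /=; rewrite !in_itv /= => /andP[->].
- rewrite -itv_dyadic_bigcup// => t /=; rewrite in_itv /= => /andP[? _].
  exact: Phi_ge0.
- exact: trivIset_dyadic.
Qed.

Let norm_dttE (r : R) : norm_dtt r%:E (EFin \o G) =
  ((\int[mu]_(t in `]0%R, +oo[) Phi r t) `^ r^-1)%E.
Proof. by congr poweR; apply: eq_integral => t _; rewrite poweR_EFin. Qed.

(** The sequence [v] may depend on [t0] but the bound [X] may not, so it survives the exhaustion of
    the half-line by the intervals from 0 to [t0]. Only large [t0] are needed. *)
Lemma norm_dtt_le q (X s0 : R) : (1 <= q)%E ->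
  (forall t0, s0 <= t0 -> 0 < t0 -> exists2 v, lqb q v X &
    forall i t, dyadic t0 i.+1 <= t < dyadic t0 i -> G t <= v i) ->
  (norm_dtt q (EFin \o G) <= X%:E)%E.
Proof.
move=> q1 H.
have X0 : 0 <= X.
  by have [||v [X0 _] _] := H (Num.max s0 1); rewrite ?le_max ?lt_max ?lexx ?ltr01 ?orbT.
case: q q1 H => [r| |]// r1 H; last first.
  apply: ge_ereal_sup => _ [t t0 <-]; rewrite lee_fin.
  have {}t0 : 0 < t by move: t0; rewrite /= in_itv /= andbT.
  pose t1 := Num.max s0 (t + 1).
  have tt1 : t < t1 by rewrite lt_max ltrDl ltr01 orbT.
  have t10 : 0 < t1 by exact: lt_trans tt1.
  have [||v [_ vX] Hv] := H t1 => //; first by rewrite le_max lexx.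
  have : `]0, t1[%classic t by rewrite /= in_itv /= t0 tt1.
  rewrite itv_dyadic_bigcup// => -[i _]; rewrite /= in_itv /= => ti.
  exact: le_trans (Hv _ _ ti) (vX i).
rewrite lee_fin in r1.
have r0 : 0 < r by lra.
rewrite norm_dttE.
suff HI : (\int[mu]_(t in `]0%R, +oo[) Phi r t <= (X `^ r)%:E)%E.
  have I0 : (0 <= \int[mu]_(t in `]0%R, +oo[) Phi r t)%E.
    apply: integral_ge0 => t /=; rewrite in_itv /= andbT; exact: Phi_ge0.
  apply: (@le_trans _ _ ((X `^ r)%:E `^ r^-1)%E).
    by apply: gt0_ler_poweR; rewrite ?invr_ge0 ?(ltW r0)// ?in_itv /= ?leey ?andbT//
      ?(le_trans I0 HI) ?lee_fin ?powR_ge0//.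
  by rewrite poweR_EFin -powRrM divff ?gt_eqF// powRr1.
(* Each right end is positive and at least [s0], hence an admissible [t0]; monotone convergence then
   gives the whole half-line. *)
pose F k := `]0, Num.max s0 1 + k%:R[%classic : set R.
have FU : `]0, +oo[%classic = \bigcup_k F k.
  apply/seteqP; split => [t|t [k _]]; rewrite /F /= !in_itv /= ?andbT; last by move=> /andP[].
  move=> t0; exists (Num.bound t) => //; rewrite /= in_itv /= t0 /=.
  have := archi_boundP (ltW t0); have : 1 <= Num.max s0 1 by rewrite le_max lexx orbT.
  by lra.
rewrite FU.
have ndF : nondecreasing_seq F.
  move=> i j ij; apply/subsetPset => t; rewrite /F /= !in_itv /= => /andP[-> /=].
  by move=> /lt_le_trans; apply; rewrite lerD2l ler_nat.
have F0 i t : F i t -> (0 <= Phi r t)%E.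
  by rewrite /F /= in_itv /= => /andP[? _]; exact: Phi_ge0.
have mF i : measurable_fun (F i) (Phi r).
  apply: measurable_funS (@measurable_Phi r) => //.
  by move=> t; rewrite /F /= !in_itv /= => /andP[->].
have cv := ge0_nondecreasing_set_cvg_integral (mu := mu) ndF
  (fun i => measurable_itv _) mF F0.
rewrite -(cvg_lim _ cv)//; apply: lime_le; first by apply/cvg_ex; eexists; exact: cv.
apply: nearW => k /=; rewrite /F; set t0 := Num.max s0 1 + k%:R.
have t00 : 0 < t0.
  have : 1 <= Num.max s0 1 by rewrite le_max lexx orbT.
  by have := ler0n R k; rewrite /t0; lra.
have [||v [_ vX] Hv] := H t0 => //.
  by rewrite /t0 -[leLHS]addr0 lerD// le_max lexx.
rewrite integral_split//; apply: lime_le.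
  apply: is_cvg_nneseries => i _ _; apply: integral_ge0 => t /=.
  by rewrite in_itv /= => /andP[/(lt_le_trans (dyadic_gt0 _ t00)) ? _]; exact: Phi_ge0.
apply: nearW => m; rewrite big_mkord.
apply: (@le_trans _ _ (\sum_(i < m) (v i `^ r)%:E)%E).
  by apply: lee_sum => i _; apply: integral_dyadic_le => //; [exact: ltW|exact: Hv].
by rewrite sumEFin lee_fin.
Qed.

Lemma norm_dtt_ge q (Y t0 : R) v : (1 <= q)%E -> 0 < t0 -> (forall i, 0 <= v i) ->
  (forall i t, dyadic t0 i.+1 <= t < dyadic t0 i -> v i <= G t) ->
  (norm_dtt q (EFin \o G) <= Y%:E)%E -> lqb q v (2 * Y).
Proof.
move=> q1 t00 v0 H; case: q q1 => [r| |]// r1 HY; last first.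
  have K i : v i <= Y.
    have ti : 0 < dyadic t0 i.+1 by exact: dyadic_gt0.
    apply: (@le_trans _ _ (G (dyadic t0 i.+1))).
      by apply: H; rewrite lexx [ltRHS]dyadicS; lra.
    rewrite -lee_fin; apply: le_trans HY; apply: ereal_sup_ubound.
    by exists (dyadic t0 i.+1) => //=; rewrite in_itv /= ti.
  have Y0 : 0 <= Y by exact: le_trans (v0 0%N) (K 0%N).
  by split => [|i]; [lra|have := K i; lra].
rewrite lee_fin in r1.
have r0 : 0 < r by lra.
rewrite norm_dttE in HY.
have I0 : (0 <= \int[mu]_(t in `]0%R, +oo[) Phi r t)%E.
  apply: integral_ge0 => t /=; rewrite in_itv /= andbT; exact: Phi_ge0.
have Y0 : 0 <= Y by rewrite -lee_fin (le_trans _ HY)// poweR_ge0.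
have HI : (\int[mu]_(t in `]0%R, +oo[) Phi r t <= (Y `^ r)%:E)%E.
  rewrite -[leLHS]poweRe1// -(mulVf (lt0r_neq0 r0)) poweRrM -poweR_EFin.
  by apply: gt0_ler_poweR; rewrite ?(ltW r0)// ?in_itv /= ?leey ?andbT// ?poweR_ge0// lee_fin.
split; first lra.
move=> m.
have K : ((\sum_(i < m) v i `^ r / 2)%:E <= (Y `^ r)%:E)%E.
  apply: le_trans HI.
  apply: (@le_trans _ _ (\int[mu]_(t in `]0%R, t0[) Phi r t)%E); last first.
    apply: ge0_subset_integral => //; first exact: measurable_Phi.
    - by move=> t /=; rewrite in_itv /= andbT; exact: Phi_ge0.
    - by move=> t /=; rewrite !in_itv /= => /andP[->].
  rewrite integral_split// -sumEFin.
  apply: (@le_trans _ _ (\sum_(i < m)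
      \int[mu]_(t in `[dyadic t0 i.+1, dyadic t0 i[) Phi r t)%E).
    by apply: lee_sum => i _; apply: integral_dyadic_ge => //; [exact: ltW|exact: H].
  rewrite -(big_mkord xpredT
    (fun i => \int[mu]_(t in `[dyadic t0 i.+1, dyadic t0 i[) Phi r t)%E).
  apply: nneseries_lim_ge => i _ _; apply: integral_ge0 => t /=.
  by rewrite in_itv /= => /andP[/(lt_le_trans (dyadic_gt0 _ t00)) ? _]; exact: Phi_ge0.
move: K; rewrite lee_fin -mulr_suml => K.
rewrite powRM//.
(* The factor 2 lost on the dyadic intervals is absorbed into [(2 * Y) ^ r], as [r >= 1]. *)
have : 2 <= 2 `^ r :> R by rewrite -[leLHS]powRr1// ler_powR// ler1n.
by have := powR_ge0 Y r; nra.
Qed.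

End norm_dtt_discretization.

(** * Rearrangements and Lorentz norms *)

Section decreasing_rearrangement.
Context (R : realType) d (T : measurableType d) (mu : {measure set T -> \bar R}).
Local Open Scope ereal_scope.
Implicit Types (f g : T -> R) (s t M : R).

Lemma measurable_superlevel f s : measurable_fun setT f ->
  measurable [set x | s < `|f x|]%R.
Proof.
move=> mf; have m : measurable_fun setT (fun x => `|f x|)%R by exact: measurableT_comp.
rewrite (_ : [set x | _] = (fun x => `|f x|%R) @^-1` `]s, +oo[%classic).
  by rewrite -[X in measurable X]setTI; exact: m.
by apply/seteqP; split => t /=; rewrite in_itv /= andbT.
Qed.

Lemma le_rearrangement f g t : measurable_fun setT f -> measurable_fun setT g ->
  (forall x, `|f x| <= `|g x|)%R -> rearrangement mu f t <= rearrangement mu g t.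
Proof.
move=> mf mg fg; apply: le_ereal_inf_tmp => _ [s [s0 Hs] <-].
apply: ereal_inf_lbound; exists s => //; split => //; apply: (le_trans _ Hs).
apply: le_measure; rewrite ?inE; [exact: measurable_superlevel..|].
by move=> x /= /lt_le_trans; apply.
Qed.

Lemma rearrangement_ge0 f t : 0 <= rearrangement mu f t.
Proof. by apply: le_ereal_inf_tmp => _ [s [s0 _] <-]; rewrite lee_fin. Qed.

Lemma rearrangement_nincr f s t : (s <= t)%R ->
  rearrangement mu f t <= rearrangement mu f s.
Proof.
move=> st; apply: ereal_inf_le_tmp => _ [u [u0 Hu] <-]; exists u => //;
by split => //; rewrite (le_trans Hu)// lee_fin.
Qed.

Section bounded.
Variables (f : T -> R) (M : R).
Hypotheses (mf : measurable_fun setT f) (fM : forall x, (`|f x| <= M)%R) (M0 : (0 <= M)%R).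

Definition rstar t : R := fine (rearrangement mu f t).

Lemma rearrangement_le_bound t : (0 <= t)%R -> rearrangement mu f t <= M%:E.
Proof.
move=> t0; apply: ereal_inf_lbound; exists M => //; split => //.
rewrite (_ : [set x | _] = set0) ?measure0//.
by apply/seteqP; split => x //=; rewrite ltNge fM.
Qed.

Lemma rearrangement_fin t : (0 <= t)%R -> rearrangement mu f t = (rstar t)%:E.
Proof.
move=> t0; rewrite /rstar fineK// ge0_fin_numE ?rearrangement_ge0//.
by apply: (le_lt_trans (rearrangement_le_bound t0)); rewrite ltry.
Qed.

Lemma rstar_ge0 t : (0 <= rstar t)%R.
Proof. by rewrite fine_ge0 ?rearrangement_ge0. Qed.

Lemma rstar_le t : (0 <= t)%R -> (rstar t <= M)%R.
Proof. by move=> t0; rewrite -lee_fin -rearrangement_fin// rearrangement_le_bound. Qed.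

Lemma rstar_nincr s t : (0 <= s)%R -> (s <= t)%R -> (rstar t <= rstar s)%R.
Proof.
move=> s0 st; rewrite -lee_fin -!rearrangement_fin//; last exact: le_trans st.
exact: rearrangement_nincr.
Qed.

Lemma lt_rstar s t : (0 <= t)%R -> (0 <= s)%R -> (s < rstar t)%R ->
  t%:E < mu [set x | s < `|f x|]%R.
Proof.
move=> t0 s0; rewrite -lte_fin -rearrangement_fin// => H.
rewrite ltNge; apply/negP => K; move: H; apply/negP; rewrite -leNgt.
by apply: ereal_inf_lbound; exists s.
Qed.

(** The infimum defining f^* is attained: this set is the increasing union of the superlevel sets
    slightly above f^*(t), each of measure at most t. *)
Lemma measure_gt_rstar t : (0 <= t)%R -> mu [set x | rstar t < `|f x|]%R <= t%:E.
Proof.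
move=> t0; pose F k := [set x | rstar t + k.+1%:R^-1 < `|f x|]%R.
have mF k : measurable (F k) by exact: measurable_superlevel.
have UF : [set x | rstar t < `|f x|]%R = \bigcup_k F k.
  apply/seteqP; split => [x /= fx|x [k _] /=].
    have /ltr_add_invr[k Hk] := fx; by exists k.
  by apply: le_lt_trans; rewrite lerDl.
have ndF : nondecreasing_seq F.
  move=> i j ij; apply/subsetPset => x /=; apply: le_lt_trans.
  by rewrite lerD2l lef_pV2 ?posrE// ler_nat.
have cv : mu \o F @ \oo --> mu (\bigcup_k F k).
  exact: nondecreasing_cvg_mu mF (bigcup_measurable (fun k _ => mF k)) ndF.
rewrite UF -(cvg_lim _ cv)//.
apply: lime_le.
  by apply: ereal_nondecreasing_is_cvgn => i j ij; apply: le_measure; rewrite ?inE//;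
    apply/subsetPset; exact: ndF.
apply: nearW => k /=.
have : ereal_inf [set s%:E | s in [set s | (0 <= s)%R /\ mu [set x | s < `|f x|]%R <= t%:E]]
    < (rstar t + k.+1%:R^-1)%:E.
  by rewrite -/(rearrangement mu f t) rearrangement_fin// lte_fin ltrDl.
move/ereal_inf_lt => [_ /= [s [s0 Hs] <-]]; rewrite lte_fin => sk.
apply: (le_trans _ Hs); apply: le_measure; rewrite ?inE//; first exact: measurable_superlevel.
by move=> x /=; apply: lt_trans.
Qed.

Lemma rstar_eq0 t : (0 <= t)%R -> mu [set x | 0 < `|f x|]%R <= t%:E -> rstar t = 0%R.
Proof.
move=> t0 H; apply/eqP; rewrite eq_le rstar_ge0 andbT -lee_fin -rearrangement_fin//.
by apply: ereal_inf_lbound; exists 0%R.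
Qed.

End bounded.
End decreasing_rearrangement.

(** * Averages over small sets, in place of g^** *)

Section small_set_integrals.
Context (R : realType) d (T : measurableType d) (mu : {measure set T -> \bar R}).
Variables (g : T -> R) (M : R).
Hypotheses (mg : measurable_fun setT g) (gM : forall x, (`|g x| <= M)%R) (M0 : (0 <= M)%R).
Local Open Scope ereal_scope.
Local Notation rs := (rstar mu g).

(** This plays the role of t g^**(t), the integral of g^* from 0 to t. A supremum over sets applies
    directly to the shells. *)
Definition sup_int (t : R) : \bar R := ereal_sup
  [set \int[mu]_(x in E) `|g x|%:E | E in [set E | measurable E /\ mu E <= t%:E]].

Let mabs : measurable_fun setT (fun x => `|g x|%:E).
Proof. by apply/measurable_EFinP; exact: measurableT_comp. Qed.

Let le_cst E (A t : R) : measurable E -> mu E <= t%:E -> (0 <= A)%R ->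
  (forall x, E x -> `|g x| <= A)%R -> \int[mu]_(x in E) `|g x|%:E <= (t * A)%:E.
Proof.
move=> mE Et A0 H; apply: (@le_trans _ _ (\int[mu]_(x in E) A%:E)).
  by apply: ge0_le_integral => //; exact: measurable_funTS.
by rewrite integral_cst// mulrC EFinM lee_wpmul2l// lee_fin.
Qed.

Lemma sup_int_ge0 t : (0 <= t)%R -> 0 <= sup_int t.
Proof.
move=> t0; apply: ereal_sup_ubound; exists set0; last by rewrite integral_set0.
by split=> //; rewrite measure0 lee_fin.
Qed.

Lemma sup_int_le t : (0 <= t)%R -> sup_int t <= (t * M)%:E.
Proof. by move=> t0; apply: ge_ereal_sup => _ [E [mE Et] <-]; exact: le_cst. Qed.

Lemma sup_int_fin t : (0 <= t)%R -> sup_int t = (fine (sup_int t))%:E.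
Proof.
move=> t0; rewrite fineK// ge0_fin_numE ?sup_int_ge0//.
by rewrite (le_lt_trans (sup_int_le t0))// ltry.
Qed.

(** A set of measure at most t is cut at height g^*(s): the part above has measure at most s, and on
    the rest |g| <= g^*(s). *)
Lemma sup_int_half (s t : R) : (0 <= s)%R -> (0 <= t)%R ->
  sup_int t <= (t * rs s)%:E + sup_int s.
Proof.
move=> s0 t0; apply: ge_ereal_sup => _ [E [mE Et] <-].
pose S := [set x | rs s < `|g x|]%R.
have mS : measurable S by exact: measurable_superlevel.
rewrite -(setUIDK E S) ge0_integral_setU//=; last 4 first.
- exact: measurableI.
- exact: measurableD.
- exact: measurable_funTS.
- by apply/disj_setPS => x [[_ Sx] [_]].
rewrite addeC; apply: leeD.
  apply: le_cst; [exact: measurableD| |exact: rstar_ge0|].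
    by apply: (le_trans _ Et); apply: le_measure; rewrite ?inE//; exact: measurableD.
  by move=> x [_]; rewrite /S /= => /negP; rewrite -leNgt.
apply: ereal_sup_ubound; exists (E `&` S) => //; split; first exact: measurableI.
apply: (@le_trans _ _ (mu S)); last exact: measure_gt_rstar.
by apply: le_measure; rewrite ?inE//; exact: measurableI.
Qed.

(* [b i] is the mean of [g] over its largest [t0 / 2^i] part, that is,
   [g^**] at [t0 / 2^i]. *)
Lemma dyadic_averages (t0 : R) : (0 < t0)%R -> exists b : nat -> R,
  [/\ forall i, (0 <= b i <= M)%R,
      forall i, (b i <= rs (dyadic t0 i.+1) + b i.+1 / 2)%R &
      forall i E, measurable E -> mu E <= (dyadic t0 i)%:E ->
        \int[mu]_(x in E) `|g x|%:E <= (dyadic t0 i * b i)%:E].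
Proof.
move=> t00; pose tau := dyadic t0.
have tau0 i : (0 < tau i)%R by exact: dyadic_gt0.
exists (fun i => fine (sup_int (tau i)) / tau i)%R; split => [i|i|i E mE Ei].
- apply/andP; split; first by rewrite divr_ge0 ?fine_ge0 ?sup_int_ge0 ?(ltW (tau0 i)).
  rewrite ler_pdivrMr// mulrC -lee_fin -sup_int_fin ?(ltW (tau0 i))//.
  by apply: sup_int_le; exact: ltW.
(* Here s = t/2: division by [tau i = 2 * tau i.+1] turns [sup_int] at the half into half of the
   next average. *)
- rewrite ler_pdivrMr//.
  have := @sup_int_half (tau i.+1) (tau i) (ltW (tau0 _)) (ltW (tau0 _)).
  rewrite (sup_int_fin (ltW (tau0 i))) (sup_int_fin (ltW (tau0 i.+1))) -EFinD lee_fin.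
  move/le_trans; apply; rewrite [in leRHS]mulrDl [in leRHS]mulrC lerD2l.
  have tE : tau i = (2 * tau i.+1)%R by exact: dyadicS.
  rewrite (_ : _ / _ / 2 * tau i = fine (sup_int (tau i.+1)))%R//.
  by rewrite tE; field; rewrite gt_eqF.
rewrite mulrCA divff ?gt_eqF// mulr1 -sup_int_fin; last exact: ltW.
by apply: ereal_sup_ubound; exists E.
Qed.

End small_set_integrals.

(** * Lorentz norms of bounded functions read on dyadic points *)

Section lorentz_discretization.
Context (R : realType) d (T : measurableType d) (mu : {measure set T -> \bar R}).
Variables (f : T -> R) (M : R).
Hypotheses (fM : forall x, `|f x| <= M) (M0 : 0 <= M).
Local Notation rs := (rstar mu f).

Lemma eq_norm_dtt q (g h : R -> \bar R) : (forall t, 0 < t -> g t = h t) ->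
  norm_dtt q g = norm_dtt q h.
Proof.
move=> gh; have {}gh t : `]0, +oo[%classic t -> g t = h t.
  by rewrite /= in_itv /= andbT; exact: gh.
case: q => [r| |]//=.
  by congr poweR; apply: eq_integral => t; rewrite inE => /gh ->.
congr ereal_sup; apply/seteqP; split => _ [t t0 <-]; exists t => //.
  by rewrite gh.
by rewrite gh.
Qed.

Lemma measurable_rstar : measurable_fun (`]0, +oo[%classic : set R) rs.
Proof.
(* Cutting the argument at 0 gives a function that is monotone on the whole line. *)
apply: (@eq_measurable_fun _ _ (measurableTypeR R) (measurableTypeR R) _
  (fun t => rs (Num.max t 0))).
  by move=> t; rewrite inE /= in_itv /= andbT => /ltW/max_idPl ->.
apply: nonincreasing_measurable => // s t st.
apply: (rstar_nincr mu fM M0); first by rewrite le_max lexx orbT.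
by rewrite ge_max !le_max st lexx orbT.
Qed.

Lemma measurable_rstar_powR (e : R) :
  measurable_fun (`]0, +oo[%classic : set R) (fun t => rs t * t `^ e).
Proof.
apply: measurable_funM; first exact: measurable_rstar.
by apply: measurable_funTS; exact: measurable_powR.
Qed.

Lemma lorentz_fin_normE p q : lorentz_norm mu p%:E q f =
  norm_dtt q (EFin \o (fun t => rs t * t `^ p^-1)).
Proof.
apply: eq_norm_dtt => t t0 /=.
by rewrite (rearrangement_fin mu fM M0) ?(ltW t0)// -EFinM.
Qed.

(** On a dyadic interval f^* is at least its value at the right end and the power at least its value
    at the left end. Moving that power to the right end costs [2 ^ p^-1]; the other 2 comes from
    [norm_dtt_ge]. *)
Lemma lorentz_norm_lqb p q (Y t0 : R) : (1 <= q)%E -> 0 < t0 -> 0 < p ->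
  (lorentz_norm mu p%:E q f <= Y%:E)%E ->
  lqb q (fun i => dyadic t0 i `^ p^-1 * rs (dyadic t0 i)) (2 `^ p^-1 * (2 * Y)).
Proof.
move=> q1 t00 p0; rewrite lorentz_fin_normE => HY.
have p10 : 0 <= p^-1 by rewrite invr_ge0 ltW.
pose v i := dyadic t0 i.+1 `^ p^-1 * rs (dyadic t0 i).
have v0 i : 0 <= v i by rewrite mulr_ge0 ?powR_ge0 ?rstar_ge0.
have H : lqb q v (2 * Y).
  apply: (norm_dtt_ge (measurable_rstar_powR p^-1) q1 t00 v0 _ HY).
  move=> i t /andP[ti it]; rewrite /v mulrC.
  have ti0 := dyadic_gt0 i.+1 t00.
  rewrite ler_pM ?powR_ge0 ?rstar_ge0//.
    by apply: (rstar_nincr mu fM M0); [exact/ltW/(lt_le_trans ti0)|exact: ltW].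
  by apply: powR_mono => //; exact: ltW.
have := lqb_scale q1 v0 (powR_ge0 2 p^-1) H.
congr lqb; apply/funext => i; rewrite /v mulrA; congr (_ * _).
by rewrite (dyadicS t0 i) powRM// ltW// dyadic_gt0.
Qed.

(** Converse to [lorentz_norm_lqb]: f^* is bounded by its value at the left end, the power by its
    value at the right end, hence the shift of index and the factor [2 ^ p^-1]. *)
Lemma lorentz_fin_norm_le p q (X s0 : R) : (1 <= q)%E -> 0 < p ->
  (forall t0, s0 <= t0 -> 0 < t0 ->
    lqb q (fun i => dyadic t0 i `^ p^-1 * rs (dyadic t0 i)) X) ->
  (lorentz_norm mu p%:E q f <= (2 `^ p^-1 * X)%:E)%E.
Proof.
move=> q1 p0 H; rewrite lorentz_fin_normE.
have p10 : 0 <= p^-1 by rewrite invr_ge0 ltW.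
apply: (norm_dtt_le (measurable_rstar_powR p^-1) _ q1 (s0 := s0)).
  by move=> t _; rewrite mulr_ge0 ?powR_ge0 ?rstar_ge0.
move=> t0 st0 t00.
exists (fun i => 2 `^ p^-1 * (dyadic t0 i.+1 `^ p^-1 * rs (dyadic t0 i.+1))).
  apply: lqb_scale => //; first by move=> i; rewrite mulr_ge0 ?powR_ge0 ?rstar_ge0.
  exact: (@lqb_shift _ q (fun i => dyadic t0 i `^ p^-1 * rs (dyadic t0 i))) (H _ st0 t00).
move=> i t /andP[ti it].
have ti0 := dyadic_gt0 i.+1 t00.
have -> : 2 `^ p^-1 * (dyadic t0 i.+1 `^ p^-1 * rs (dyadic t0 i.+1)) =
    rs (dyadic t0 i.+1) * dyadic t0 i `^ p^-1.
  by rewrite (dyadicS t0 i) powRM ?(ltW ti0)//; ring.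
rewrite ler_pM ?powR_ge0 ?rstar_ge0//.
  by apply: (rstar_nincr mu fM M0) => //; exact: ltW.
by apply: powR_mono => //; [exact/ltW/(lt_le_trans ti0)|exact: ltW].
Qed.

Definition rstar_primitive (t : R) : R :=
  fine (\int[@lebesgue_measure R]_(s in `]0%R, t[) rearrangement mu f s)%E.
Local Notation K := rstar_primitive.

Let mrE : measurable_fun (`]0, +oo[%classic : set R) (rearrangement mu f).
Proof.
apply: (eq_measurable_fun (EFin \o rs)).
  move=> t; rewrite inE /= in_itv /= andbT => t0.
  by rewrite (rearrangement_fin mu fM M0)// ltW.
by apply/measurable_EFinP; exact: measurable_rstar.
Qed.

Let mrS (A : set (measurableTypeR R)) : A `<=` `]0, +oo[%classic ->
  measurable_fun A (rearrangement mu f).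
Proof. by move=> A0; apply: measurable_funS mrE. Qed.

Lemma rstar_primitiveE t : 0 <= t ->
  (\int[@lebesgue_measure R]_(s in `]0%R, t[) rearrangement mu f s = (K t)%:E)%E.
Proof.
move=> t0; rewrite /K fineK// ge0_fin_numE; last first.
  by apply: integral_ge0 => s _; exact: rearrangement_ge0.
apply: (@le_lt_trans _ _ (\int[@lebesgue_measure R]_(s in `]0%R, t[) M%:E)%E).
  apply: ge0_le_integral => //.
  - by move=> s _; exact: rearrangement_ge0.
  - by apply: mrS => s /=; rewrite !in_itv /= => /andP[->].
  move=> s; rewrite /= in_itv /= => /andP[s0 _].
  by apply: (rearrangement_le_bound mu fM M0); exact: ltW.
rewrite integral_cst//= lebesgue_measure_itv/= lte_fin.
by case: ifP => _; rewrite ?mule0 ?sube0 -?EFinM ltry.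
Qed.

Lemma rstar_primitive_increment a b : 0 < a -> a <= b ->
  (b - a) * rs b <= K b - K a <= (b - a) * rs a.
Proof.
move=> a0; rewrite le_eqVlt => /predU1P[<-|ab]; first by rewrite !subrr !mul0r lexx.
have b0 := lt_trans a0 ab.
have KE : ((K b)%:E = (K a)%:E + \int[@lebesgue_measure R]_(s in `[a, b[) rearrangement mu f s)%E.
  rewrite -!rstar_primitiveE ?ltW// -ge0_integral_setU//=.
  - by congr integral; rewrite -itv_bndbnd_setU// bnd_simp ltW.
  - by apply: mrS => s /=; rewrite !in_itv /= => -[/andP[->]|/andP[/(lt_le_trans a0) ->]].
  - by move=> s _; exact: rearrangement_ge0.
  - apply/disj_setPS => s [] /=; rewrite !in_itv /= => /andP[_ sa] /andP[].
    by rewrite leNgt sa.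
have I1 : (((b - a) * rs b)%:E <= \int[@lebesgue_measure R]_(s in `[a, b[) rearrangement mu f s)%E.
  apply: (@le_trans _ _ (\int[@lebesgue_measure R]_(s in `[a, b[) (rs b)%:E)%E).
    by rewrite integral_cst//= lebesgue_measure_itv/= lte_fin ab -EFinB -EFinM mulrC.
  apply: ge0_le_integral => //.
  - by move=> s _; rewrite lee_fin rstar_ge0.
  - by apply: mrS => s /=; rewrite !in_itv /= => /andP[/(lt_le_trans a0) ->].
  move=> s; rewrite /= in_itv /= => /andP[as_ sb].
  have s0 := lt_le_trans a0 as_.
  rewrite (rearrangement_fin mu fM M0) ?(ltW s0)// lee_fin.
  by apply: (rstar_nincr mu fM M0); exact: ltW.
have I2 : (\int[@lebesgue_measure R]_(s in `[a, b[) rearrangement mu f s <= ((b - a) * rs a)%:E)%E.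
  apply: (@le_trans _ _ (\int[@lebesgue_measure R]_(s in `[a, b[) (rs a)%:E)%E); last first.
    by rewrite integral_cst//= lebesgue_measure_itv/= lte_fin ab -EFinB -EFinM mulrC.
  apply: ge0_le_integral => //.
  - by move=> s _; exact: rearrangement_ge0.
  - by apply: mrS => s /=; rewrite !in_itv /= => /andP[/(lt_le_trans a0) ->].
  move=> s; rewrite /= in_itv /= => /andP[as_ sb].
  have s0 := lt_le_trans a0 as_.
  rewrite (rearrangement_fin mu fM M0) ?(ltW s0)// lee_fin.
  by apply: (rstar_nincr mu fM M0) => //; exact: ltW.
move: KE I1 I2; case: integral => [z| |]//= -[KE]; rewrite !lee_fin => I1 I2.
have -> : K b - K a = z by rewrite KE; ring.
by rewrite I1 I2.
Qed.

Lemma rstar_primitive_bounds t (L : R) : 0 < t -> (forall s, 0 < s -> rs s <= L) ->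
  t * rs t <= K t <= t * L.
Proof.
move=> t0 HL; rewrite -!lee_fin -!rstar_primitiveE ?(ltW t0)//.
apply/andP; split.
  apply: (@le_trans _ _ (\int[@lebesgue_measure R]_(s in `]0%R, t[) (rs t)%:E)%E).
    by rewrite integral_cst//= lebesgue_measure_itv/= lte_fin t0 sube0 -EFinM mulrC.
  apply: ge0_le_integral => //.
  - by move=> s _; rewrite lee_fin rstar_ge0.
  - by apply: mrS => s /=; rewrite !in_itv /= => /andP[->].
  move=> s; rewrite /= in_itv /= => /andP[s0 st].
  rewrite (rearrangement_fin mu fM M0) ?(ltW s0)// lee_fin.
  by apply: (rstar_nincr mu fM M0); exact: ltW.
apply: (@le_trans _ _ (\int[@lebesgue_measure R]_(s in `]0%R, t[) L%:E)%E); last first.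
  by rewrite integral_cst//= lebesgue_measure_itv/= lte_fin t0 sube0 -EFinM mulrC.
apply: ge0_le_integral => //.
- by move=> s _; exact: rearrangement_ge0.
- by apply: mrS => s /=; rewrite !in_itv /= => /andP[->].
move=> s; rewrite /= in_itv /= => /andP[s0 st].
by rewrite (rearrangement_fin mu fM M0) ?(ltW s0)// lee_fin HL.
Qed.

(** This is f^** - f^*, real-valued because f is bounded. *)
Definition oscillation (t : R) : R := t^-1 * K t - rs t.

Lemma oscillation_ge0 t : 0 < t -> 0 <= oscillation t.
Proof.
move=> t0; have /andP[H _] := rstar_primitive_bounds t0
  (fun s s0 => rstar_le mu fM M0 (ltW s0)).
by rewrite subr_ge0 mulrC ler_pdivlMr// mulrC.
Qed.

Lemma measurable_oscillation : measurable_fun (`]0, +oo[%classic : set R) oscillation.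
Proof.
apply: measurable_funB; last exact: measurable_rstar.
apply: measurable_funM.
  apply: subspace_continuous_measurable_fun => //.
  apply: continuous_in_subspaceT => t; rewrite inE /= in_itv /= andbT => t0.
  by apply: inv_continuous; rewrite gt_eqF.
apply: (@eq_measurable_fun _ _ (measurableTypeR R) (measurableTypeR R) _
  (fun t => if 0 < t then K t else 0)).
  by move=> t; rewrite inE /= in_itv /= andbT => ->.
apply: nondecreasing_measurable => // s t st.
case: ifPn => s0; last by case: ifPn => // t0; rewrite fine_ge0 ?integral_ge0//
  => u _; exact: rearrangement_ge0.
rewrite (lt_le_trans s0 st).
have /andP[H _] := rstar_primitive_increment s0 st.
by rewrite -subr_ge0 (le_trans _ H)// mulr_ge0 ?subr_ge0// rstar_ge0.
Qed.

Lemma lorentz_infty_normE q :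
  lorentz_norm mu +oo%E q f = norm_dtt q (EFin \o oscillation).
Proof.
apply: eq_norm_dtt => t t0 /=.
rewrite /maximal_rearrangement (rstar_primitiveE (ltW t0)).
by rewrite (rearrangement_fin mu fM M0) ?(ltW t0)// -EFinM -EFinB.
Qed.

(** With b = 2a, the integral of f^* from a to b is at most a f^*(a). Multiplied by b, the claim is
    this bound rearranged, and the ratio 1/2 is a/b. *)
Lemma oscillation_dyadic_rec (t0 : R) i : 0 < t0 ->
  oscillation (dyadic t0 i) <=
    2^-1 * oscillation (dyadic t0 i.+1) + (rs (dyadic t0 i.+1) - rs (dyadic t0 i)).
Proof.
move=> t00; have a0 := dyadic_gt0 i.+1 t00.
have bE := dyadicS t0 i.
set a := dyadic t0 i.+1 in a0 bE *; set b := dyadic t0 i in bE *.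
have ab : a <= b by rewrite bE; lra.
have b0 : 0 < b by exact: lt_le_trans ab.
have /andP[_ H] := rstar_primitive_increment a0 ab.
rewrite -(ler_pM2l b0) /oscillation.
have -> : b * (b^-1 * K b - rs b) = K b - b * rs b by field; rewrite gt_eqF.
have -> : b * (2^-1 * (a^-1 * K a - rs a) + (rs a - rs b)) =
    K a - a * rs a + b * (rs a - rs b) by rewrite bE; field; rewrite gt_eqF.
rewrite bE in H *; lra.
Qed.

(** Near 0, f^* increases to its supremum L, which is finite since f is bounded; as f^** <= L, the
    oscillation is at most L - f^*. *)
Lemma oscillation_dyadic_cvg0 (t0 : R) : 0 < t0 ->
  oscillation (dyadic t0 i) @[i --> \oo] --> 0.
Proof.
move=> t00; pose u i := rs (dyadic t0 i).
have nd : nondecreasing_seq u.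
  move=> i j ij; apply: (rstar_nincr mu fM M0); last exact: dyadic_nincr.
  exact/ltW/dyadic_gt0.
have ub : has_ubound (range u).
  exists M => _ [i _ <-]; apply: (rstar_le mu fM M0); exact/ltW/dyadic_gt0.
have cu := nondecreasing_cvgn nd ub.
set L := sup (range u) in cu.
have HL s : 0 < s -> rs s <= L.
  move=> s0; have [N HN] := dyadic_small t00 s0.
  apply: (@le_trans _ _ (u N)).
    by apply: (rstar_nincr mu fM M0) => //; exact/ltW/dyadic_gt0.
  by apply: ub_le_sup => //; exists N.
apply: (@squeeze_cvgr _ _ _ _ (fun=> 0) (fun i => L - u i)).
- apply: nearW => i; have ti := dyadic_gt0 i t00.
  rewrite oscillation_ge0//= /oscillation lerD2r.
  have /andP[_ H] := rstar_primitive_bounds ti HL.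
  by rewrite mulrC ler_pdivrMr// mulrC.
- exact: cvg_cst.
- by rewrite -(subrr L); apply: cvgB => //; exact: cvg_cst.
Qed.

Lemma lorentz_infty_norm_le q (X s0 : R) : (1 <= q)%E ->
  (forall t0, s0 <= t0 -> 0 < t0 ->
    lqb q (fun i => oscillation (dyadic t0 i)) X) ->
  (lorentz_norm mu +oo%E q f <= (2 * X)%:E)%E.
Proof.
move=> q1 H; rewrite lorentz_infty_normE.
apply: (norm_dtt_le measurable_oscillation oscillation_ge0 q1 (s0 := s0)).
move=> t0 st0 t00; exists (fun i => 2 * oscillation (dyadic t0 i)).
  apply: lqb_scale => //; last exact: H.
  by move=> i; apply: oscillation_ge0; exact: dyadic_gt0.
move=> i t /andP[ti it].
have a0 := dyadic_gt0 i.+1 t00.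
have t_gt0 := lt_le_trans a0 ti.
have bE := dyadicS t0 i.
set b := dyadic t0 i in it bE *; have b0 : 0 < b by exact: lt_trans it.
have bt : b <= 2 * t by rewrite bE; lra.
have /andP[H1 _] := rstar_primitive_increment t_gt0 (ltW it).
have H2 : rs b <= rs t by apply: (rstar_nincr mu fM M0); exact: ltW.
have o0 := oscillation_ge0 b0.
have H3 : t * oscillation t <= b * oscillation b.
  rewrite /oscillation.
  have -> : t * (t^-1 * K t - rs t) = K t - t * rs t by field; rewrite gt_eqF.
  have -> : b * (b^-1 * K b - rs b) = K b - b * rs b by field; rewrite gt_eqF.
  by nra.
by rewrite -(ler_pM2l t_gt0) (le_trans H3)// mulrA ler_wpM2r// mulrC.
Qed.

End lorentz_discretization.

Section monotonicity.
Context (R : realType).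

(** The integral of a nonnegative function is a supremum over simple functions below it, so
    monotonicity holds for arbitrary functions. Lorentz norms can then be compared without
    measurability of the rearrangements. *)
Lemma ge0_le_integral_nonmeasurable d (T : measurableType d) (mu : {measure set T -> \bar R})
    (D : set T) (f g : T -> \bar R) :
  (forall x, D x -> (0 <= f x <= g x)%E) ->
  (\int[mu]_(x in D) f x <= \int[mu]_(x in D) g x)%E.
Proof.
move=> fg; rewrite (integral_mkcond D) [leRHS](integral_mkcond D).
have f0 x : (0 <= (f \_ D) x)%E by apply: erestrict_ge0 => y /fg /andP[].
have fg' x : ((f \_ D) x <= (g \_ D) x)%E by apply: lee_restrict => y /fg /andP[].
rewrite !ge0_integralTE//; last by move=> x; exact: le_trans (fg' x).
apply: le_ereal_sup => _ [h hf <-]; exists h => // x.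
exact: le_trans (hf x) (fg' x).
Qed.

Lemma le_norm_dtt q (g h : R -> \bar R) : (1 <= q)%E ->
  (forall t, 0 < t -> (0 <= g t <= h t)%E) -> (norm_dtt q g <= norm_dtt q h)%E.
Proof.
move=> + gh; have {}gh t : `]0, +oo[%classic t -> (0 <= g t <= h t)%E /\ 0 < t.
  by rewrite /= in_itv /= andbT => t0; split => //; exact: gh.
case: q => [r| |]//=; last first.
  move=> _; apply: ge_ereal_sup => _ [t t0 <-].
  apply: le_trans (_ : h t <= _)%E; first by have [/andP[]] := gh t t0.
  by apply: ereal_sup_ubound; exists t.
rewrite lee_fin => r1; have r0 : 0 < r by exact: lt_le_trans r1.
have I (k : R -> \bar R) :
    (0 <= \int[@lebesgue_measure R]_(t in `]0%R, +oo[) (k t `^ r * t^-1%:E))%E.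
  apply: integral_ge0 => t; rewrite /= in_itv /= andbT => t0.
  by rewrite mule_ge0 ?poweR_ge0// lee_fin invr_ge0 ltW.
apply: gt0_ler_poweR; rewrite ?invr_ge0 ?(ltW r0)// ?in_itv /= ?leey ?andbT ?I//.
apply: ge0_le_integral_nonmeasurable => t /gh[/andP[g0 gt] t0].
have ti : (0 <= t^-1%:E)%E by rewrite lee_fin invr_ge0 ltW.
rewrite mule_ge0 ?poweR_ge0//= lee_wpmul2r//.
apply: gt0_ler_poweR; rewrite ?(ltW r0)// ?in_itv /= ?leey ?andbT//.
exact: le_trans gt.
Qed.

Lemma le_lorentz_norm d (T : measurableType d) (mu : {measure set T -> \bar R})
    (p : R) q (f g : T -> R) : (1 <= q)%E ->
  measurable_fun setT f -> measurable_fun setT g -> (forall x, `|f x| <= `|g x|) ->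
  (lorentz_norm mu p%:E q f <= lorentz_norm mu p%:E q g)%E.
Proof.
move=> q1 mf mg fg; apply: le_norm_dtt => // t t0.
have p0 : (0 <= (t `^ p^-1)%:E)%E by rewrite lee_fin powR_ge0.
by rewrite mule_ge0 ?rearrangement_ge0//= lee_wpmul2r// le_rearrangement.
Qed.

Lemma lorentz_norm_fin_ge0 T (mu : set T -> \bar R) (p : R) q (f : T -> R) :
  (1 <= q)%E -> (0 <= lorentz_norm mu p%:E q f)%E.
Proof.
case: q => [r _| _|]//=; first exact: poweR_ge0.
have r0 : (0 <= rearrangement mu f 1)%E.
  by apply: le_ereal_inf_tmp => _ [s [s0 _] <-]; rewrite lee_fin.
apply: (@le_trans _ _ (rearrangement mu f 1 * (1 `^ p^-1)%:E)%E).
  by rewrite mule_ge0// lee_fin powR_ge0.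
by apply: ereal_sup_ubound; exists 1 => //=; rewrite in_itv /= ltr01.
Qed.

End monotonicity.

(** * First order *)

Section dyadic_level_drop.
Context (R : realType) (n : nat).
Local Notation T := (n.-tuple (measurableTypeR R)).
Local Notation mu := (@lebesgue_measure_tuple R n).
Variables (f : 'rV[R]_n -> R) (M t0 : R).
Hypotheses (n_gt0 : (0 < n)%N) (C1f : C1_rV f) (fM : forall x, `|f x| <= M)
  (dfM : forall l x, `|partial l f x| <= M) (M0 : 0 <= M) (t00 : 0 < t0).

Local Notation ft := (fun t : T => f (row_of_tuple t)).
Local Notation gt l := (fun t : T => partial l f (row_of_tuple t)).
Local Notation x i := (rstar mu ft (dyadic t0 i)).

(** Strict inequalities on both sides make the shells disjoint and place each one in a superlevel
    set of f^*; where f^* is flat the shell is empty. *)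
Definition shell i := [set t : T | x i < `|ft t| < x i.+1].
Definition shell_int l i : R := fine (\int[mu]_(t in shell i) `|gt l t|%:E)%E.

Let mf : measurable_fun setT ft.
Proof. by apply: continuous_measurable_row; case: C1f. Qed.

Let mg l : measurable_fun setT (gt l).
Proof. by apply: continuous_measurable_row; case: C1f => _ /(_ l)[]. Qed.

Let tau0 i : 0 < dyadic t0 i. Proof. exact: dyadic_gt0. Qed.

Let ftM t : `|ft t| <= M. Proof. exact: fM. Qed.

Lemma measurable_shell i : measurable (shell i).
Proof. exact: (measurable_level_set C1f). Qed.

Lemma measure_shell i : (mu (shell i) <= (dyadic t0 i)%:E)%E.
Proof.
apply: (le_trans _ (measure_gt_rstar mu mf ftM M0 (ltW (tau0 i)))).
apply: le_measure; rewrite ?inE; [exact: measurable_shell|exact: measurable_superlevel|].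
by move=> t /= /andP[].
Qed.

Lemma shell_int_ge0 l i : 0 <= shell_int l i.
Proof. by apply: fine_ge0; apply: integral_ge0. Qed.

Lemma shell_intE l i :
  (\int[mu]_(t in shell i) `|gt l t|%:E)%E = (shell_int l i)%:E.
Proof.
rewrite /shell_int fineK// ge0_fin_numE ?integral_ge0//.
have [b [_ _ /(_ i (shell i) (measurable_shell i) (measure_shell i))]] :=
  dyadic_averages mu (mg l) (fun t => dfM l _) M0 t00.
by move/le_lt_trans; apply; rewrite ltry.
Qed.

(** The level set estimate with [lam = x i] and [Lam] just below [x i.+1], where the set |f| >= Lam
    has measure at least half of [tau]. The 8 is 2 from that half, 2 from the estimate and 2 from
    the side [r]. *)
Lemma level_drop i : (x i.+1 - x i) * dyadic t0 i <=
  8 * dyadic t0 i `^ n%:R^-1 * \sum_l shell_int l i.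
Proof.
set tau := dyadic t0 i; set K := leRHS.
have S0 : 0 <= \sum_l shell_int l i by apply: sumr_ge0 => l _; exact: shell_int_ge0.
have K0 : 0 <= K by rewrite /K !mulr_ge0// powR_ge0.
have tau_gt0 : 0 < tau by exact: tau0.
have tauE : tau = 2 * dyadic t0 i.+1 by exact: dyadicS.
have main Lam : x i < Lam < x i.+1 -> (Lam - x i) * tau <= K.
  move=> /andP[L1 L2].
  have x0 : 0 <= x i by exact: rstar_ge0.
  (* As n >= 1, [r ^ n = 2 ^ n * tau] is at least [2 * tau]. *)
  pose r := 2 * tau `^ n%:R^-1.
  have r0 : 0 < r by rewrite mulr_gt0// powR_gt0.
  have rn : 2 * tau <= r ^+ n.
    rewrite exprMn -powR_mulrn ?powR_ge0// -powR_mulrn ?powR_ge0// -powRrM.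
    rewrite mulVf ?pnatr_eq0 -?lt0n// powRr1 ?(ltW tau_gt0)// ler_wpM2r ?(ltW tau_gt0)//.
    by rewrite -[leLHS]powRr1// ler_powR// ler1n.
  have := @level_set_estimate R n f (x i) Lam C1f (ltW L1) r r0.
  have E1 : (mu [set t | (x i < `|ft t|)%R] <= tau%:E)%E.
    exact: (measure_gt_rstar mu mf ftM M0 (ltW tau_gt0)).
  have E2 : (2%:E * mu [set t | (x i < `|ft t|)%R] <= (r ^+ n)%:E)%E.
    apply: (@le_trans _ _ (2%:E * tau%:E)%E); first by rewrite lee_wpmul2l.
    by rewrite -EFinM lee_fin.
  move=> /(_ E2) H.
  have E3 : ((dyadic t0 i.+1)%:E <= mu [set t | (Lam <= `|ft t|)%R])%E.
    have L0 : 0 <= Lam by rewrite (le_trans x0)// ltW.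
    apply: (le_trans (ltW (lt_rstar ftM M0 (ltW (tau0 i.+1)) L0 L2))).
    have mL : measurable [set t | Lam <= `|ft t|].
      have m : measurable_fun setT (fun t => `|ft t|) by exact: measurableT_comp.
      rewrite (_ : [set t | _] = (fun t => `|ft t|) @^-1` `[Lam, +oo[%classic).
        by rewrite -[X in measurable X]setTI; exact: m.
      by apply/seteqP; split => t /=; rewrite in_itv /= andbT.
    apply: le_measure; rewrite ?inE//; first exact: measurable_superlevel.
    by move=> t /=; exact: ltW.
  have E4 l : (\int[mu]_t truncated_partial f (x i) Lam l t <= (shell_int l i)%:E)%E.
    rewrite -shell_intE.
    rewrite (_ : (fun t => _) = (fun t => `|gt l t|%:E) \_ [set t | (x i < `|ft t| < Lam)%R])//.
    rewrite -integral_mkcond; apply: ge0_subset_integral => //.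
    - exact: (measurable_level_set C1f).
    - exact: measurable_shell.
    - apply: measurable_funTS; apply/measurable_EFinP; exact: measurableT_comp.
    - by move=> t /= /andP[a b]; rewrite /shell /= a (lt_trans b L2).
  have E5 : ((Lam - x i)%:E * (dyadic t0 i.+1)%:E <=
      (2 * r)%:E * \sum_l (shell_int l i)%:E)%E.
    apply: le_trans (le_trans H _).
      by rewrite lee_wpmul2l// lee_fin subr_ge0 ltW.
    apply: lee_wpmul2l; first by rewrite lee_fin mulr_ge0// ltW.
    by apply: lee_sum => l _; exact: E4.
  move: E5; rewrite sumEFin -!EFinM lee_fin /r /K tauE.
  by set s := \sum_l _; nra.
have [xx|xx] := leP (x i.+1) (x i).
  by apply: le_trans K0; rewrite mulr_le0_ge0 ?subr_le0// ltW.
(* If the bound failed, the midpoint of [x i + K / tau] and [x i.+1] would be a level contradicting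
   [main]. *)
rewrite leNgt; apply/negP => H.
have H1 : x i + K / tau < x i.+1 by rewrite -ltrBrDl ltr_pdivrMr.
have K1 : 0 <= K / tau by rewrite divr_ge0// ltW.
have /main : x i < (x i + K / tau + x i.+1) / 2 < x i.+1.
  by apply/andP; split; lra.
rewrite -ler_pdivlMr//; lra.
Qed.

(* The shells are disjoint and contained in a set of measure at most [t0]. *)
Lemma sum_shell_int l m (B : R) :
  (forall E, measurable E -> (mu E <= t0%:E)%E ->
     \int[mu]_(t in E) `|gt l t|%:E <= B%:E)%E ->
  \sum_(i < m) shell_int l i <= B.
Proof.
move=> HB; rewrite -lee_fin -sumEFin.
pose E := \big[setU/set0]_(i < m) shell i.
have mE : measurable E by apply: bigsetU_measurable => i _; exact: measurable_shell.
have tI : trivIset setT shell.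
  apply/trivIsetP => i j _ _.
  wlog ij : i j / (i < j)%N.
    move=> H; rewrite neq_ltn => /orP[ij|ji]; first by apply: H => //; rewrite ltn_eqF.
    by rewrite setIC; apply: H => //; rewrite ltn_eqF.
  move=> _; apply/seteqP; split => t //= [/andP[_ a] /andP[b _]].
  have := lt_trans b a; apply/negP; rewrite -leNgt.
  apply: (rstar_nincr mu ftM M0); first exact/ltW/tau0.
  exact: dyadic_nincr.
apply: (@le_trans _ _ (\int[mu]_(t in E) `|gt l t|%:E)%E).
  rewrite /E ge0_integral_bigsetU//=.
  - by apply: lee_sum => i _; rewrite shell_intE.
  - by move=> i; exact: measurable_shell.
  - exact: index_enum_uniq.
  - by apply/trivIsetP => i j _ _ ij; move/trivIsetP : tI; apply.
  - apply: measurable_funTS; apply/measurable_EFinP; exact: measurableT_comp.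
apply: HB => //.
apply: (le_trans _ (measure_gt_rstar mu mf ftM M0 (ltW t00))).
apply: le_measure; rewrite ?inE//; first exact: measurable_superlevel.
rewrite /E => t; rewrite -bigcup_mkord => -[i _] /= /andP[a _].
apply: le_lt_trans a; apply: (rstar_nincr mu ftM M0); first exact/ltW/tau0.
by rewrite -[leRHS]dyadic0 dyadic_nincr.
Qed.

End dyadic_level_drop.

Section dyadic_powers.
Context (R : realType).
Implicit Types e : R.

Lemma dyadic_powRS (t0 e : R) i : 0 < t0 ->
  dyadic t0 i `^ e = 2 `^ e * dyadic t0 i.+1 `^ e.
Proof. by move=> t00; rewrite dyadicS powRM// ltW// dyadic_gt0. Qed.

Lemma dyadic_powR_cvg0 (t0 e M : R) : 0 < t0 -> 0 < e -> 0 <= M ->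
  dyadic t0 i `^ e * M @[i --> \oo] --> 0.
Proof.
move=> t00 e0 M0; apply/cvgrPdist_le => eps eps0.
have c0 : 0 < eps / (M + 1) by rewrite divr_gt0//; lra.
have [N HN] := dyadic_small t00 (powR_gt0 e^-1 c0).
exists N => // i /= Ni; rewrite sub0r normrN ger0_norm ?mulr_ge0 ?powR_ge0//.
apply: (@le_trans _ _ (eps / (M + 1) * M)); last first.
  by rewrite mulrAC ler_pdivrMr ?ler_pM2l//; lra.
rewrite ler_wpM2r//.
rewrite -[leRHS]powRr1; last exact: ltW.
rewrite -[X in _ <= _ `^ X](mulVf (lt0r_neq0 e0)) powRrM.
apply: powR_mono; [exact: ltW|exact/ltW/dyadic_gt0|].
exact: (le_trans (dyadic_nincr t00 Ni)).
Qed.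

Lemma powR_lt1 e : e < 0 -> 2 `^ e < 1 :> R.
Proof.
move=> e0; rewrite -[ltRHS](powRr0 2) lt_neqAle ler_powR ?ler1n// ?(ltW e0)// andbT.
apply/eqP => H; have := ln_powR 2 e; rewrite H powRr0 ln1 => /esym/eqP.
rewrite mulf_eq0 (lt_eqF e0) /= gt_eqF//; by rewrite ln_gt0// ltr1n.
Qed.

End dyadic_powers.

(** * Weighted l^q bounds for the shell integrals and the drops *)

Section drop_bound.
Context (R : realType) (n : nat).
Local Notation T := (n.-tuple (measurableTypeR R)).
Local Notation mu := (@lebesgue_measure_tuple R n).

(* The constants of Hardy's inequality with exponent [p > 1], and of the case
   [p = q = 1]. *)
Definition hardy_const (p : R) : R :=
  if p == 1 then 2 else 2 * 2 `^ (p^-1 - 1) / (1 - 2 `^ (p^-1 - 1)).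

Lemma hardy_const_ge0 (p : R) : 1 <= p -> 0 <= hardy_const p.
Proof.
move=> p1; rewrite /hardy_const; case: eqP => // /eqP pN1.
have {}p1 : 1 < p by rewrite lt_neqAle eq_sym pN1.
have : 2 `^ (p^-1 - 1) < 1 :> R by rewrite powR_lt1// subr_lt0 invf_lt1//; lra.
by move=> ?; rewrite divr_ge0 ?mulr_ge0 ?powR_ge0//; lra.
Qed.

Variables (f : 'rV[R]_n -> R) (M t0 p : R) (q : \bar R) (Y : 'I_n -> R).
Hypotheses (n_gt0 : (0 < n)%N) (C1f : C1_rV f) (fM : forall x, `|f x| <= M)
  (dfM : forall l x, `|partial l f x| <= M) (M0 : 0 <= M) (t00 : 0 < t0)
  (q1 : (1 <= q)%E) (pq : 1 < p \/ p = 1 /\ q = 1%E).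
Local Notation gt l := (fun t : T => partial l f (row_of_tuple t)).
Local Notation tau i := (dyadic t0 i).
Local Notation x i := (rstar mu (fun t : T => f (row_of_tuple t)) (tau i)).
Hypothesis HY : forall l, lqb q (fun i => tau i `^ p^-1 * rstar mu (gt l) (tau i)) (Y l).

Let mg l : measurable_fun setT (gt l).
Proof. by apply: continuous_measurable_row; case: C1f => _ /(_ l)[]. Qed.

Let tau0 i : 0 < tau i. Proof. exact: dyadic_gt0. Qed.

(** For p > 1 this is a discrete Hardy inequality for the averages [b], which dominate the shell
    integrals. For p = q = 1 that recursion has ratio 1, and disjointness of the shells takes its
    place. *)
Lemma shell_bound l :
  lqb q (fun i => tau i `^ (p^-1 - 1) * shell_int f t0 l i) (hardy_const p * Y l).
Proof.
have [b [bM brec bint]] := dyadic_averages mu (mg l) (fun t => dfM l _) M0 t00.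
set y := fun i => rstar mu (gt l) (tau i).
have y0 i : 0 <= y i by exact: rstar_ge0.
have sb i : shell_int f t0 l i <= tau i * b i.
  rewrite -lee_fin -(shell_intE C1f fM dfM M0 t00).
  by apply: bint; [exact: measurable_shell|exact: (measure_shell C1f fM M0 t00)].
have [p_gt1|[pE qE]] := pq.
  have pN1 : p == 1 = false by rewrite gt_eqF.
  rewrite /hardy_const pN1.
  (* Multiplied by the weight [tau i ^ e], the recursion of [b] has ratio [2 ^ e / 2 = th], which is
     below 1 because p > 1. *)
  set e := p^-1; set th := 2 `^ (e - 1).
  have e0 : 0 < e by rewrite invr_gt0; lra.
  have th1 : th < 1 by rewrite powR_lt1// subr_lt0 invf_lt1//; lra.
  have th0 : 0 < th by rewrite powR_gt0.
  have thE : 2 `^ e = 2 * th.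
    by rewrite /th powRD ?powRN ?powRr1// ?pnatr_eq0 ?implybT//; field.
  have [Y0 _] := HY l.
  pose bt i := tau i `^ e * b i.
  have bt0 i : 0 <= bt i by rewrite mulr_ge0 ?powR_ge0//; case/andP: (bM i).
  apply: (@lqb_mono _ _ _ bt _ q1) => [i|].
    rewrite mulr_ge0 ?powR_ge0 ?shell_int_ge0//=.
    apply: (le_trans (ler_wpM2l (powR_ge0 _ _) (sb i))).
    rewrite mulrA -{2}(powRr1 (ltW (tau0 i))) -powRD ?subrK ?le_refl//.
    by apply/implyP => _; rewrite gt_eqF.
  apply: (@lqb_backward _ q bt (fun i => 2 * th / (1 - th) * (tau i.+1 `^ e * y i.+1)) _ th).
  - exact: q1.
  - by rewrite ltW.
  - exact: bt0.
  - move=> i; apply: mulr_ge0; last by rewrite mulr_ge0 ?powR_ge0.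
    by apply: divr_ge0; lra.
  - apply: (@squeeze_cvgr _ _ _ _ (fun=> 0) (fun i => tau i `^ e * M)).
    + apply: nearW => i; rewrite bt0 /= ler_wpM2l ?powR_ge0//.
      by case/andP: (bM i).
    + exact: cvg_cst.
    + exact: dyadic_powR_cvg0.
  - move=> i; rewrite /bt (dyadic_powRS e i t00) thE -/e.
    have := brec i; rewrite -/(y i.+1) => brec_i.
    have te : 0 <= tau i.+1 `^ e by exact: powR_ge0.
    have -> : (1 - th) * (2 * th / (1 - th) * (tau i.+1 `^ e * y i.+1)) =
       2 * th * (tau i.+1 `^ e * y i.+1) by field; rewrite subr_eq0 gt_eqF.
    apply: (@le_trans _ _ (2 * th * tau i.+1 `^ e * (y i.+1 + b i.+1 / 2))).
      by rewrite ler_wpM2l// !mulr_ge0// ltW.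
    by rewrite le_eqVlt; apply/orP; left; apply/eqP; field.
  apply: lqb_scale => //.
  - by move=> i; rewrite mulr_ge0 ?powR_ge0.
  - by apply: divr_ge0; lra.
  - exact: (@lqb_shift _ q (fun i => tau i `^ e * y i) _ (HY l)).
have := HY l; rewrite qE => -[Y0 HYl].
rewrite /hardy_const pE eqxx; split; first lra.
move=> m.
rewrite powRr1; last lra.
rewrite (eq_bigr (fun i : 'I_m => shell_int f t0 l i)); last first.
  move=> i _; rewrite invr1 subrr powRr0 mul1r powRr1//.
  exact: shell_int_ge0.
(* All shells together lie in one set of measure at most [t0], over which |g| integrates to at most
   [t0 * b 0]. *)
apply: (@le_trans _ _ (t0 * b 0%N)).
  apply: (sum_shell_int C1f fM dfM M0 t00) => E mE Et0.
  by have := bint 0%N E mE; rewrite dyadic0; apply.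
have M1 : 0 < M + 1 by rewrite ltr_wpDl.
apply/ler_addgt0Pr => eps eps0.
have [N HN] : exists N, tau N <= eps / (M + 1).
  by apply: dyadic_small => //; rewrite divr_gt0.
(* With p = 1 the recursion of [b] telescopes; the remainder [tau k * b k] is at most [tau k * M],
   hence small. *)
have H k : t0 * b 0%N <= 2 * \sum_(i < k) (tau i.+1 `^ p^-1 * y i.+1) + tau k * b k.
  elim: k => [|k IH]; first by rewrite big_ord0 mulr0 add0r dyadic0.
  apply: (le_trans IH); rewrite big_ord_recr /= mulrDr -addrA lerD2l.
  rewrite pE invr1 powRr1 ?(ltW (tau0 _))// (dyadicS t0 k).
  by have := brec k; have := tau0 k.+1; rewrite -/(y k.+1); nra.
apply: (le_trans (H N)); apply: lerD.
  rewrite ler_wpM2l//.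
  apply: le_trans (_ : \sum_(i < N.+1) (tau i `^ p^-1 * y i) `^ 1 <= _).
    rewrite big_ord_recl /= ler_wpDl ?powR_ge0//.
    by apply: ler_sum => i _; rewrite powRr1// mulr_ge0 ?powR_ge0.
  by have := HYl N.+1; rewrite [in X in _ <= X -> _]powRr1.
have /andP[b0 bM'] := bM N.
apply: (@le_trans _ _ (eps / (M + 1) * M)).
  by apply: ler_pM => //; exact: ltW.
by rewrite mulrAC ler_pdivrMr ?ler_pM2l// lerDl ler01.
Qed.

(** [level_drop] gains [tau ^ (1/n - 1)], which converts the weight of the drops into the weight of
    [shell_bound]; the components of the gradient are then added. *)
Lemma drop_bound :
  lqb q (fun i => tau i `^ (p^-1 - n%:R^-1) * (x i.+1 - x i))
    (8 * (2 ^+ n * \sum_l hardy_const p * Y l)).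
Proof.
have H : lqb q (fun i => \sum_l tau i `^ (p^-1 - 1) * shell_int f t0 l i)
    (2 ^+ n * \sum_l hardy_const p * Y l).
  have sn : size (index_enum 'I_n) = n by rewrite -[RHS]card_ord cardE enumT.
  rewrite (_ : 2 ^+ n = 2 ^+ size (index_enum 'I_n)); last by rewrite sn.
  apply: lqb_sum => // [l i|l]; last exact: shell_bound.
  by rewrite mulr_ge0 ?powR_ge0 ?shell_int_ge0.
have fM' t : `|f (@row_of_tuple R n t)| <= M by exact: fM.
apply: lqb_mono (lqb_scale q1 _ _ H) => //; last first.
  by move=> i; apply: sumr_ge0 => l _; rewrite mulr_ge0 ?powR_ge0 ?shell_int_ge0.
move=> i; apply/andP; split.
  rewrite mulr_ge0 ?powR_ge0// subr_ge0.
  by apply: (rstar_nincr mu fM' M0); [exact: ltW|exact: dyadic_nincr].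
have := level_drop n_gt0 C1f fM dfM M0 t00 i.
rewrite -ler_pdivlMr// => D.
apply: (le_trans (ler_wpM2l (powR_ge0 _ _) D)).
rewrite -mulr_sumr.
have -> : tau i `^ (p^-1 - 1) = tau i `^ (p^-1 - n%:R^-1) * tau i `^ n%:R^-1 / tau i.
  have tn : tau i != 0 by rewrite gt_eqF.
  rewrite -powRD; last by rewrite tn implybT.
  rewrite subrK powRB; last by rewrite tn implybT.
  by rewrite powRr1// ltW.
rewrite le_eqVlt; apply/orP; left; apply/eqP; ring.
Qed.

End drop_bound.

(** * The first-order inequality, for finite and infinite target exponent *)

Section one_step.
Context (R : realType) (n : nat).
Local Notation T := (n.-tuple (measurableTypeR R)).
Local Notation mu := (@lebesgue_measure_tuple R n).

Variables (p : R) (q pbar : \bar R).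
Hypotheses (n_gt0 : (0 < n)%N) (q1 : (1 <= q)%E) (p1 : 1 <= p)
  (pq : 1 < p \/ p = 1 /\ q = 1%E) (pbar1 : (1 <= pbar)%E).

(** [C] is fixed before [f], [M] and [s0]: the last two serve only to make quantities finite, to
    pass to limits and to start the recursion. *)
Lemma lorentz_norm_gradient :
  (pbar^-1)%E = (p^-1 - n%:R^-1)%:E -> exists2 C : R, 0 < C &
  forall (f : 'rV[R]_n -> R) (M s0 : R), C1_rV f -> 0 <= M ->
  (forall x, `|f x| <= M) -> (forall l x, `|partial l f x| <= M) ->
  (mu [set t : T | (0 < `|f (row_of_tuple t)|)%R] <= s0%:E)%E ->
  (lorentz_norm mu pbar q (fun t : T => f (row_of_tuple t)) <=
   C%:E * \sum_l lorentz_norm mu p%:E q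
     (fun t : T => partial l f (row_of_tuple t)))%E.
Proof.
have p0 : 0 < p by exact: lt_le_trans p1.
move=> pbarE; pose c0 : R := 8 * (2 ^+ n * (hardy_const p * (2 `^ p^-1 * 2))).
have c00 : 0 <= c0.
  by rewrite !mulr_ge0 ?exprn_ge0 ?powR_ge0 ?hardy_const_ge0.
(* It remains to pass from the drops of f^* to the norm of f, which is where the finite and infinite
   target exponents differ. *)
suff [C C0 HC] : exists2 C : R, 0 <= C &
    forall (f : 'rV[R]_n -> R) (M s0 D : R), C1_rV f -> 0 <= M ->
    (forall x, `|f x| <= M) -> (forall l x, `|partial l f x| <= M) ->
    (mu [set t : T | (0 < `|f (row_of_tuple t)|)%R] <= s0%:E)%E ->
    (forall t0, 0 < t0 -> lqb q (fun i => dyadic t0 i `^ (p^-1 - n%:R^-1) *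
      (rstar mu (fun t : T => f (row_of_tuple t)) (dyadic t0 i.+1) -
       rstar mu (fun t : T => f (row_of_tuple t)) (dyadic t0 i))) D) ->
    (lorentz_norm mu pbar q (fun t : T => f (row_of_tuple t)) <= (C * D)%:E)%E.
  have C1 : 0 < C * c0 + 1 by apply: ltr_wpDl => //; exact: mulr_ge0.
  exists (C * c0 + 1) => //.
  move=> f M s0 C1f M0 fM dfM supp.
  pose N l := lorentz_norm mu p%:E q (fun t : T => partial l f (row_of_tuple t)).
  have gM l (t : T) : `|partial l f (row_of_tuple t)| <= M by exact: dfM.
  have N0 l : (0 <= N l)%E by exact: lorentz_norm_fin_ge0.
  (* If some component has infinite norm, the right side is [+oo], since the 1 added to the constant
     keeps it positive. *)
  have [/existsP[l /eqP Nl]|/existsPn Nfin] := boolP [exists l, N l == +oo%E].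
    apply: (@le_trans _ _ ((C * c0 + 1)%:E * \sum_l N l)%E); last by [].
    rewrite (bigD1 l)//= Nl addye; last first.
      by rewrite gt_eqF// (lt_le_trans (ltNyr 0))// sume_ge0.
    by rewrite gt0_muley ?leey.
  pose Y l := fine (N l).
  have NE l : N l = (Y l)%:E by rewrite /Y fineK// ge0_fin_numE// ltey Nfin.
  have Y0 l : 0 <= Y l by exact: fine_ge0.
  have HY t0 l : 0 < t0 -> lqb q (fun i => dyadic t0 i `^ p^-1 *
      rstar mu (fun t : T => partial l f (row_of_tuple t)) (dyadic t0 i))
      (2 `^ p^-1 * (2 * Y l)).
    move=> t00; apply: (lorentz_norm_lqb (gM l) M0 q1 t00 p0).
    by rewrite -/(N l) NE.
  have D := fun t0 (t00 : 0 < t0) => drop_bound n_gt0 C1f fM dfM M0 t00 q1 pq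
    (fun l => HY t0 l t00).
  apply: (le_trans (HC f M s0 _ C1f M0 fM dfM supp D)).
  rewrite (eq_bigr (fun l => (Y l)%:E)); last by move=> l _; exact: NE.
  rewrite sumEFin -EFinM lee_fin.
  have -> : \sum_l hardy_const p * (2 `^ p^-1 * (2 * Y l)) =
      hardy_const p * (2 `^ p^-1 * 2) * \sum_l Y l.
    by rewrite mulr_sumr; apply: eq_bigr => l _; rewrite !mulrA.
  rewrite /c0 !mulrA mulrDl mul1r lerDl.
  by apply: sumr_ge0.
move: pbarE; case: pbar pbar1 => [r| |]//; last first.
  (* Here the weight exponent is 0. In 4, one factor 2 is that of [lorentz_infty_norm_le] and the
     other is 1/(1 - th) with th = 1/2. *)
  move=> _; rewrite invey => -[/esym sE]; exists 4 => //.
  move=> f M s0 D C1f M0 fM dfM _ HD.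
  have gM (t : T) : `|f (row_of_tuple t)| <= M by exact: fM.
  rewrite (_ : 4 * D = 2 * (2 * D)); last by ring.
  apply: (lorentz_infty_norm_le (s0 := 0) gM M0 q1) => t0 _ t00.
  have drop0 i : 0 <= rstar mu (fun t : T => f (row_of_tuple t)) (dyadic t0 i.+1) -
       rstar mu (fun t : T => f (row_of_tuple t)) (dyadic t0 i).
    rewrite subr_ge0; apply: (rstar_nincr mu gM M0); last exact: dyadic_nincr.
    exact/ltW/dyadic_gt0.
  have H : lqb q (fun i => 2 * (rstar mu (fun t : T => f (row_of_tuple t)) (dyadic t0 i.+1) -
       rstar mu (fun t : T => f (row_of_tuple t)) (dyadic t0 i))) (2 * D).
    apply: lqb_scale => //.
    have := HD t0 t00; congr lqb; apply/funext => i.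
    by rewrite sE powRr0 mul1r.
  apply: (lqb_backward (th := 2^-1) q1 _ _ _ _ _ H).
  - by rewrite invr_ge0 ler0n /= invf_lt1// ltr1n.
  - by move=> i; apply: (oscillation_ge0 mu gM M0); exact: dyadic_gt0.
  - by move=> i; rewrite mulr_ge0.
  - exact: (oscillation_dyadic_cvg0 mu gM M0).
  - move=> i; apply: (le_trans (oscillation_dyadic_rec mu gM M0 i t00)).
    by rewrite lerD2l mulrA (_ : (1 - 2^-1) * 2 = 1 :> R) ?mul1r//; field.
rewrite lee_fin => r1.
have r0 : 0 < r by exact: lt_le_trans r1.
rewrite inver gt_eqF// => -[sE].
set s := p^-1 - n%:R^-1 in sE *.
have s_gt0 : 0 < s by rewrite -sE invr_gt0.
(* Passing from [tau i] to [tau i.+1] multiplies the weight by [th], so f^* at the new point is the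
   old weighted value times [th] plus a weighted drop, with equality. *)
pose th : R := 2 `^ (- s).
have th0 : 0 < th by rewrite powR_gt0.
have th1 : th < 1 by rewrite powR_lt1// oppr_lt0.
have th2 : 0 <= th / (1 - th) by rewrite divr_ge0 ?subr_ge0 ?ltW.
exists (2 `^ s * (th / (1 - th))).
  by rewrite mulr_ge0 ?powR_ge0.
move=> f M s0 D C1f M0 fM dfM supp HD.
have gM (t : T) : `|f (row_of_tuple t)| <= M by exact: fM.
rewrite -mulrA -[in 2 `^ s]sE.
apply: (lorentz_fin_norm_le (s0 := s0) gM M0 q1 r0) => t0 st0 t00.
set rs := rstar mu _ in HD *.
have drop0 i : 0 <= rs (dyadic t0 i.+1) - rs (dyadic t0 i).
  rewrite subr_ge0; apply: (rstar_nincr mu gM M0); last exact: dyadic_nincr.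
  exact/ltW/dyadic_gt0.
have H : lqb q (fun i => th / (1 - th) * (dyadic t0 i `^ s *
    (rs (dyadic t0 i.+1) - rs (dyadic t0 i)))) (th / (1 - th) * D).
  apply: lqb_scale => //; last exact: HD.
  by move=> i; rewrite mulr_ge0 ?powR_ge0.
apply: (lqb_forward (th := th) q1 _ _ _ _ _ H).
- by rewrite ltW.
- by move=> i; rewrite mulr_ge0 ?powR_ge0 ?rstar_ge0.
- by move=> i; apply: mulr_ge0 => //; rewrite mulr_ge0 ?powR_ge0.
(* As [t0 >= s0], which bounds the measure of the set where f is nonzero, f^* vanishes at [t0]. *)
- rewrite dyadic0 (_ : rs t0 = 0) ?mulr0//.
  apply: (rstar_eq0 gM M0); first exact: ltW.
  by apply: (le_trans supp); rewrite lee_fin.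
move=> i; rewrite sE (dyadic_powRS s i t00).
have thE : th * 2 `^ s = 1 by rewrite -powRD ?addNr ?powRr0// pnatr_eq0 implybT.
set u := dyadic t0 i.+1 `^ s; set a := rs _; set b := rs _.
have -> : th * (2 `^ s * u * b) = u * b by rewrite !mulrA thE mul1r.
have -> : (1 - th) * (th / (1 - th) * (2 `^ s * u * (a - b))) = u * (a - b).
  rewrite [LHS]mulrA (_ : (1 - th) * (th / (1 - th)) = th).
    by rewrite !mulrA thE mul1r.
  by rewrite mulrC divfK// subr_eq0 gt_eqF.
by rewrite -mulrDr addrC subrK.
Qed.

End one_step.

(** * Higher orders *)

Section smooth_functions.
Context (R : realType) (n : nat).
Local Notation T := (n.-tuple (measurableTypeR R)).
Local Notation mu := (@lebesgue_measure_tuple R n).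
Implicit Types (f : 'rV[R]_n -> R) (s : seq 'I_n).

Lemma smooth_C1 f : smooth f -> C1_rV f.
Proof.
move=> sf; have [cf df] := sf [::]; split => // i; split; first by move=> x; exact: df.
by have [] := sf [:: i].
Qed.

Lemma partials_cat s1 s2 f : partials (s1 ++ s2) f = partials s1 (partials s2 f).
Proof. exact: foldr_cat. Qed.

Lemma smooth_partials f s : smooth f -> smooth (partials s f).
Proof. by move=> sf s'; rewrite -partials_cat. Qed.

Lemma smooth_partial f i : smooth f -> smooth (partial i f).
Proof. exact: (@smooth_partials f [:: i]). Qed.

(** Off the closed support f vanishes in a neighbourhood, and so does the difference quotient in the
    limit. *)
Lemma compactly_supported_partial f i :
  compactly_supported f -> compactly_supported (partial i f).
Proof.
move=> cf; apply: (subclosed_compact _ cf); first exact: closed_closure.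
rewrite [X in _ `<=` X](closure_id _).1; last exact: closed_closure.
apply: closureS => x /= dfx; apply: contrapT => nx.
move: dfx; rewrite /partial; apply/negP; rewrite negbK; apply/eqP.
rewrite (@near_eq_derive _ _ _ f (cst 0)) ?derive_cst//.
have oU : open (~` closure [set x | f x != 0]).
  exact/closed_openC/closed_closure.
apply: filterS (open_nbhs_nbhs (conj oU nx)) => y /= ny.
by apply: contrapT => fy; apply: ny; apply: subset_closure; exact/eqP.
Qed.

Lemma compactly_supported_le f : continuous f -> compactly_supported f ->
  exists2 M, 0 <= M & forall x, `|f x| <= M.
Proof.
move=> cf cs; have cabs : continuous (fun x => `|f x|).
  by move=> x; apply: continuous_comp; [exact: cf|exact: norm_continuous].
have supp x : f x != 0 -> closure [set x | f x != 0] x by move=> fx; exact: subset_closure.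
have [[x0 x0S]|/set0P/negP] := pselect (closure [set x | f x != 0] !=set0); last first.
  rewrite negbK => /eqP S0; exists 0 => // x; have [->|/supp] := eqVneq (f x) 0.
    by rewrite normr0.
  by rewrite S0.
have [c cS cmax] := @compact_EVT_max _ R (fun x => `|f x|) _ (ex_intro _ x0 x0S) cs
   (continuous_subspaceT cabs).
exists `|f c| => // x; have [->|/supp xS] := eqVneq (f x) 0; first by rewrite normr0.
by apply: cmax; rewrite inE.
Qed.

(** A compact set is bounded in the maximum norm, hence contained in a cube. *)
Lemma compactly_supported_measure f : continuous f -> compactly_supported f ->
  exists s0 : R, (mu [set t : T | (0 < `|f (row_of_tuple t)|)%R] <= s0%:E)%E.
Proof.
move=> cf cs; have [K [_ HK]] := compact_bounded cs.
have {}HK := HK (`|K| + 1) ltac:(rewrite (le_lt_trans (ler_norm _))// ltrDl//).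
set B := `|K| + 1 in HK; have B0 : 0 <= B by rewrite addr_ge0.
exists ((B + B) ^+ n).
have mI (i : 'I_n) : measurable (`[- B, B]%classic : set (measurableTypeR R)).
  exact: measurable_itv.
have -> : ((B + B) ^+ n)%:E = mu [set t : T | forall i, `[- B, B]%classic (tnth t i)].
  rewrite (lebesgue_measure_tuple_box mI) (eq_bigr (fun=> (B + B)%:E)); last first.
    move=> i _; rewrite lebesgue_measure_itv /= lte_fin.
    case: ltP => [_|BB]; first by rewrite -EFinB opprK.
    by congr EFin; move: BB B0; clear; lra.
  by rewrite prodEFin prodr_const card_ord.
apply: le_measure; rewrite ?inE.
- apply: measurable_superlevel; exact: continuous_measurable_row.
- exact: (measurable_tuple_box mI).
move=> t /= ft i; rewrite in_itv /= -ler_norml.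
have /HK : closure [set x | f x != 0] (row_of_tuple t).
  by apply: subset_closure; rewrite /= -normr_gt0.
apply: le_trans; rewrite [leRHS]mx_normrE.
have -> : tnth t i = row_of_tuple t 0 i by rewrite mxE.
by rewrite (le_bigmax _ (fun ij => `|row_of_tuple t ij.1 ij.2|) (0, i)).
Qed.

End smooth_functions.

(** * Commutation of partial derivatives and comparison with |D^k f| *)

Section symmetry_of_partials.
Context (R : realType) (n : nat).
Implicit Types (f : 'rV[R]_n -> R) (s : seq 'I_n).
Local Notation e i := (delta_mx 0 i : 'rV[R]_n).

Lemma is_derive_line f i (x : 'rV[R]_n) (u : R) :
  (forall y, derivable f y (e i)) ->
  is_derive u 1 (fun u : R => f (u *: e i + x)) (partial i f (u *: e i + x)).
Proof.
move=> df; have [d1 d2] := derive_line (df (u *: e i + x)).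
by apply: DeriveDef => //; rewrite -derive1E d2.
Qed.

Lemma MVT_increment (g dg : R -> R) (h : R) : 0 < h ->
  (forall u : R, is_derive u 1 g (dg u)) ->
  exists2 c, 0 < c < h & g h - g 0 = dg c * h.
Proof.
move=> h0 H; have [|c + ->] := MVT h0 (fun u _ => H u).
- apply: continuous_subspaceT => u; apply/differentiable_continuous.
  by apply/derivable1_diffP; have [] := H u.
- by rewrite in_itv /= subr0 => ?; exists c.
Qed.

(** The mean value theorem is used in direction [i] on the difference of two parallel lines, then in
    direction [j] on the derivative so obtained. *)
Lemma second_difference f i j (x : 'rV[R]_n) (h : R) : smooth f -> 0 < h ->
  exists u v, [/\ 0 < u < h, 0 < v < h &
  f (h *: e i + (h *: e j + x)) - f (h *: e i + x) -
    (f (0 *: e i + (h *: e j + x)) - f (0 *: e i + x)) =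
  partial j (partial i f) (v *: e j + (u *: e i + x)) * h * h].
Proof.
move=> sf h0.
have df i' y : derivable f y (e i') by have [_] := sf [::]; apply.
have ddf y : derivable (partial i f) y (e j) by have [_] := sf [:: i]; apply.
have [u u0h uE] := @MVT_increment
  (fun u => f (u *: e i + (h *: e j + x)) - f (u *: e i + x))
  (fun u => partial i f (u *: e i + (h *: e j + x)) - partial i f (u *: e i + x)) h h0
  (fun u => is_deriveB (is_derive_line (h *: e j + x) u (df i)) (is_derive_line x u (df i))).
have [v v0h vE] := @MVT_increment
  (fun v => partial i f (v *: e j + (u *: e i + x)))
  (fun v => partial j (partial i f) (v *: e j + (u *: e i + x))) h h0
  (fun v => is_derive_line (u *: e i + x) v ddf).
exists u, v; split => //; rewrite uE -vE; congr (_ * _).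
by rewrite scale0r add0r addrCA.
Qed.

Lemma dist_le_halves (a b c d : R) :
  `|a - c| <= d / 2 -> `|b - c| <= d / 2 -> `|a - b| <= d.
Proof.
move=> ac bc; rewrite (_ : a - b = (a - c) - (b - c)); last by ring.
by rewrite (le_trans (ler_normB _ _))// (splitr d) lerD.
Qed.

(** Schwarz's theorem: the same second difference equals h^2 times either mixed derivative at points
    close to [x], and both are continuous there. *)
Lemma partialC f i j : smooth f -> partial i (partial j f) = partial j (partial i f).
Proof.
move=> sf; apply/funext => x.
have c1 : continuous (partial i (partial j f)) by have [] := sf [:: i; j].
have c2 : continuous (partial j (partial i f)) by have [] := sf [:: j; i].
apply/eqP; rewrite -subr_eq0 -normr_eq0 eq_le normr_ge0 andbT.
apply/ler_addgt0Pr => eps eps0; rewrite add0r.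
have eps2 : 0 < eps / 2 by exact: divr_gt0.
have /cvgrPdist_le/(_ _ eps2)/nbhs_ballP[d1 /= d10 H1] := c1 x.
have /cvgrPdist_le/(_ _ eps2)/nbhs_ballP[d2 /= d20 H2] := c2 x.
(* The half leaves room for two displacements, each shorter than [h], inside both balls. *)
pose h := Num.min d1 d2 / 2.
have h0 : 0 < h by rewrite divr_gt0// lt_min d10 d20.
have hd d : Num.min d1 d2 <= d -> forall i' j' u v, 0 < u < h -> 0 < v < h ->
    ball x d (v *: e j' + (u *: e i' + x)).
  move=> dd i' j' u v /andP[u0 uh] /andP[v0 vh].
  rewrite -ball_normE /= (_ : x - _ = - (v *: e j' + u *: e i')); last first.
    by rewrite addrA opprD addrCA subrr addr0.
  rewrite normrN (le_lt_trans (ler_normD _ _))//.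
  have le1 w k : 0 < w -> `|w *: e k| <= w.
    move=> w0; rewrite normrZ gtr0_norm// ler_piMr ?(ltW w0)//.
    have -> : `|e k : 'rV[R]_n| = mx_norm (e k) by [].
    rewrite mx_normrE; apply: bigmax_le => // ab _.
    by rewrite mxE; case: (_ && _); rewrite /= ?normr0 ?normr1.
  have := le1 v j' v0; have := le1 u i' u0.
  move: uh vh; rewrite /h; move: dd; set m := Num.min d1 d2; clear; lra.
have [u [v [uh vh E1]]] := second_difference i j x sf h0.
have [u' [v' [uh' vh' E2]]] := second_difference j i x sf h0.
have E : partial j (partial i f) (v *: e j + (u *: e i + x)) =
    partial i (partial j f) (v' *: e i + (u' *: e j + x)).
  have hn := lt0r_neq0 h0.
  have cancel (a b : R) : a * h * h = b * h * h -> a = b by move=> /(mulIf hn)/(mulIf hn).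
  apply: cancel.
  have swap (A B C D : R) : A - B - (C - D) = A - C - (B - D) by ring.
  apply: (eq_trans (esym E1)); apply: (eq_trans _ E2).
  by rewrite !scale0r !add0r (addrCA (h *: e i) (h *: e j) x) swap.
have d1m : Num.min d1 d2 <= d1 by rewrite ge_min lexx.
have d2m : Num.min d1 d2 <= d2 by rewrite ge_min lexx orbT.
have := H1 _ (hd _ d1m j i u' v' uh' vh'); rewrite -E => A1.
have A2 := H2 _ (hd _ d2m i j u v uh vh).
exact: dist_le_halves A1 A2.
Qed.

Lemma partial_partials f i s : smooth f ->
  partial i (partials s f) = partials s (partial i f).
Proof.
move=> sf; elim: s => //= j s <-.
by apply: partialC; exact: smooth_partials.
Qed.

Lemma perm_partials f s1 s2 : smooth f -> perm_eq s1 s2 ->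
  partials s1 f = partials s2 f.
Proof.
move=> sf; elim: s1 s2 => [|i s1 IH] s2.
  by rewrite perm_sym => /perm_nilP ->.
move=> ps; have is2 : i \in s2 by rewrite -(perm_mem ps) mem_head.
case/splitPr: is2 ps => a b ps; have {ps} : perm_eq s1 (a ++ b).
  rewrite -(perm_cons i) (perm_trans ps)//.
  exact: (permEl (perm_catCA a [:: i] b)).
move/IH => IHs.
rewrite partials_cat /= -partial_partials; last exact: smooth_partials.
by rewrite -partials_cat -IHs.
Qed.

(** Iterating first-order steps yields derivatives in any order, while [norm_Dk] has one per
    multi-index in a fixed order; by symmetry each of the former is one of the latter. *)
Lemma le_norm_Dk f k s (x : 'rV[R]_n) : smooth f -> size s = k ->
  `|partials s f x| <= norm_Dk k f x.
Proof.
move=> sf sk.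
(* The multi-index of [s] counts occurrences; a count is at most [size s = k], so [inord] keeps its
   value. *)
pose a : {ffun 'I_n -> 'I_k.+1} := [ffun i => inord (count_mem i s)].
have aE i : a i = count_mem i s :> nat.
  by rewrite ffunE inordK// ltnS -sk count_size.
have pa : perm_eq s (flatten [seq nseq (a i) i | i <- enum 'I_n]).
  apply/allP => i _ /=; apply/eqP.
  rewrite count_flatten -map_comp sumnE big_map big_enum /= (bigD1 i)//=.
  rewrite big1 ?addn0; last by move=> j ji; rewrite count_nseq /= (negbTE ji).
  by rewrite count_nseq /= eqxx mul1n aE.
have ak : (\sum_i a i == k)%N.
  apply/eqP; rewrite -[RHS]sk (perm_size pa) size_flatten /shape -map_comp.
  by rewrite sumnE big_map big_enum /=; apply: eq_bigr => i _; rewrite size_nseq.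
rewrite (perm_partials sf pa) -sqrtr_sqr ler_wsqrtr// (bigD1 a)//= lerDl.
by apply: sumr_ge0 => b _; exact: sqr_ge0.
Qed.

End symmetry_of_partials.

Lemma measurable_bigsum d (X : measurableType d) (R : realType) (I : Type)
    (s : seq I) (P : pred I) (h : I -> X -> R) :
  (forall i, measurable_fun setT (h i)) ->
  measurable_fun setT (fun x => \sum_(i <- s | P i) h i x).
Proof.
move=> mh; elim: s => [|i s IH].
  rewrite (_ : (fun x => _) = cst 0); first exact: measurable_cst.
  by apply/funext => x; rewrite big_nil.
rewrite (_ : (fun x => _) = (fun x => (if P i then h i x else 0) +
    \sum_(j <- s | P j) h j x)).
  by apply: measurable_funD => //; case: (P i).
by apply/funext => x; rewrite big_cons; case: (P i); rewrite ?add0r.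
Qed.

(** * Iteration over the order of differentiation *)

Section higher_order.
Context (R : realType) (n : nat).
Local Notation T := (n.-tuple (measurableTypeR R)).
Local Notation mu := (@lebesgue_measure_tuple R n).
Implicit Types (f : 'rV[R]_n -> R).

Lemma lorentz_norm_partial (p : R) (q pbar : \bar R) :
  (0 < n)%N -> (1 <= q)%E -> 1 <= p -> 1 < p \/ p = 1 /\ q = 1%E -> (1 <= pbar)%E ->
  (pbar^-1)%E = (p^-1 - n%:R^-1)%:E ->
  exists2 C : R, 0 < C & forall f (Y : \bar R), smooth f -> compactly_supported f ->
    (0 <= Y)%E ->
    (forall l, lorentz_norm mu p%:E q (partial l f \o @row_of_tuple R n) <= Y)%E ->
    (lorentz_norm mu pbar q (f \o @row_of_tuple R n) <= C%:E * Y)%E.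
Proof.
move=> n0 q1 p1 pq pbar1 pbarE.
have [C C0 H] := lorentz_norm_gradient n0 q1 p1 pq pbar1 pbarE.
exists (C * n%:R); first by rewrite mulr_gt0// ltr0n.
move=> f Y sf cf Y0 HY.
have cont (g : 'rV[R]_n -> R) : smooth g -> continuous g by move=> /(_ [::])[].
have [M0 M00 fM0] := compactly_supported_le (cont _ sf) cf.
have /choice[M1 HM1] l : exists M, 0 <= M /\ forall x, `|partial l f x| <= M.
  have [M ? ?] := compactly_supported_le (cont _ (smooth_partial l sf))
    (@compactly_supported_partial R n f l cf).
  by exists M.
have M1s l : M1 l <= \sum_l M1 l.
  by rewrite (bigD1 l)//= lerDl; apply: sumr_ge0 => i _; case: (HM1 i).
have S0 : 0 <= \sum_l M1 l by apply: sumr_ge0 => i _; case: (HM1 i).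
have [s0 Hs0] := compactly_supported_measure (cont _ sf) cf.
have {}H := H f (M0 + \sum_l M1 l) s0 (smooth_C1 sf) _ _ _ Hs0.
apply: (le_trans (H _ _ _)).
- by rewrite addr_ge0.
- by move=> x; rewrite (le_trans (fM0 x))// lerDl.
- move=> l x; have [_ /(_ x) h] := HM1 l.
  by rewrite (le_trans h)// (le_trans (M1s l))// lerDr.
rewrite EFinM -muleA lee_wpmul2l//; first by rewrite lee_fin ltW.
apply: (@le_trans _ _ (\sum_(l < n) Y)%E); first by apply: lee_sum => l _; exact: HY.
by rewrite big_const_ord iter_addr addr0 -[X in (X <= _)%E]mule_natl.
Qed.

(** The induction hypothesis takes the first derivatives of f from [p] to an intermediate exponent,
    and one first-order step leads from there to [pbar]. The case p = q = 1 thus occurs only at the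
    first-order step starting from [p]. *)
Lemma lorentz_norm_partials (k : nat) (p : R) (q pbar : \bar R) :
  (0 < n)%N -> (1 <= q)%E -> 1 <= p -> 1 < p \/ p = 1 /\ q = 1%E -> (1 <= pbar)%E ->
  (pbar^-1)%E = (p^-1 - k.+1%:R / n%:R)%:E ->
  exists2 C : R, 0 < C & forall f (Y : \bar R), smooth f -> compactly_supported f ->
    (0 <= Y)%E ->
    (forall s, size s = k.+1 ->
      lorentz_norm mu p%:E q (partials s f \o @row_of_tuple R n) <= Y)%E ->
    (lorentz_norm mu pbar q (f \o @row_of_tuple R n) <= C%:E * Y)%E.
Proof.
move=> n0 q1 p1 pq; elim: k pbar => [|k IH] pbar pbar1 pbarE.
  have [|C C0 H] := lorentz_norm_partial n0 q1 p1 pq pbar1.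
    by rewrite pbarE mul1r.
  exists C => // f Y sf cf Y0 HY; apply: H => // l.
  exact: (HY [:: l]).
have nR : 0 < n%:R :> R by rewrite ltr0n.
have p0 : 0 < p by exact: lt_le_trans p1.
have s0 : 0 <= p^-1 - k.+2%:R / n%:R.
  by rewrite -lee_fin -pbarE inve_ge0 (le_trans _ pbar1).
(* [e] is the reciprocal of the intermediate exponent. It exceeds [pbar^-1 >= 0] by 1/n and is less
   than 1/p <= 1, so that exponent is finite and larger than 1, and the first-order step applies for
   every [q]. *)
pose e := p^-1 - k.+1%:R / n%:R.
have eE : p^-1 - k.+2%:R / n%:R = e - n%:R^-1.
  by rewrite /e -[k.+2]addn1 natrD mulrDl mul1r opprD addrA.
have e0 : 0 < e.
  have : 0 < n%:R^-1 :> R by rewrite invr_gt0.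
  by move: s0; rewrite eE; clear; lra.
have e1 : e < 1.
  have : p^-1 <= 1 by rewrite invf_le1.
  have : 0 < k.+1%:R / n%:R :> R by rewrite divr_gt0.
  by rewrite /e; clear; lra.
have p'1 : 1 < e^-1 by rewrite invf_gt1.
have [|C1 C10 H1] := @lorentz_norm_partial e^-1 q pbar n0 q1 (ltW p'1) (or_introl p'1) pbar1.
  by rewrite pbarE eE invrK.
have [||C2 C20 H2] := IH e^-1%:E.
- by rewrite lee_fin ltW.
- by rewrite inver gt_eqF ?invr_gt0// invrK.
exists (C1 * C2); first exact: mulr_gt0.
move=> f Y sf cf Y0 HY; rewrite EFinM -muleA; apply: H1 => //.
  by rewrite mule_ge0// lee_fin ltW.
move=> l; apply: H2 => //.
- exact: smooth_partial.
- exact: compactly_supported_partial.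
(* The derivative in direction [l] acts first, so it is the last entry of the sequence. *)
move=> s sk; have := HY (rcons s l).
by rewrite size_rcons sk /partials foldr_rcons; apply.
Qed.

Lemma measurable_norm_Dk f k : smooth f ->
  measurable_fun setT (norm_Dk k f \o @row_of_tuple R n).
Proof.
move=> sf; apply: (measurableT_comp (continuous_measurable_fun (@sqrt_continuous R))).
apply: measurable_bigsum => a; apply: measurable_funX.
by apply: continuous_measurable_row; have [] := sf (flatten [seq nseq (a i) i | i <- enum 'I_n]).
Qed.

End higher_order.

Theorem theorem2 (R : realType) (n k : nat) (p : R) (q pbar : \bar R)
    (n_ge1 : (1 <= n)%N) (k_ge1 : (1 <= k)%N) (le_kn : (k <= n)%N)
    (p_ge1 : 1 <= p) (p_le : p <= n%:R / k%:R)
    (q_ge1 : (1 <= q)%E) (pbar_ge1 : (1 <= pbar)%E)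
    (pbarE : (pbar^-1)%E = (p^-1 - k%:R / n%:R)%:E)
    (cases : ((k < n)%N /\
               ((1 < p /\ p <= n%:R / k%:R /\ (1 <= q)%E) \/
                (p = 1 /\ q = 1%E))) \/
             (k = n /\ p = 1 /\ q = 1%E)) :
  exists c : R, forall f : 'rV[R]_n -> R,
    smooth f -> compactly_supported f ->
    (lorentz_norm (@lebesgue_measure_rV R n) pbar q f <=
      c%:E * lorentz_norm (@lebesgue_measure_rV R n) p%:E q (norm_Dk k f))%E.
Proof.
have pq : 1 < p \/ p = 1 /\ q = 1%E by case: cases => [[_ [[]|]]|[_]]; auto.
case: k k_ge1 pbarE {le_kn p_le cases} => // k _ pbarE.
have [c _ H] := lorentz_norm_partials n_ge1 q_ge1 p_ge1 pq pbar_ge1 pbarE.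
exists c => f sf cf.
have rVE r g : lorentz_norm (@lebesgue_measure_rV R n) r q g =
    lorentz_norm (lebesgue_measure_tuple R n) r q (g \o @row_of_tuple R n) by [].
(* The norm of |D^k f| serves as the common bound [Y] for all derivatives of this order. *)
have le_Dk s : size s = k.+1 ->
    (lorentz_norm (lebesgue_measure_tuple R n) p%:E q (partials s f \o @row_of_tuple R n) <=
     lorentz_norm (lebesgue_measure_tuple R n) p%:E q (norm_Dk k.+1 f \o @row_of_tuple R n))%E.
  move=> sk; apply: le_lorentz_norm => //.
  - by apply: continuous_measurable_row; have [] := sf s.
  - exact: measurable_norm_Dk.
  - by move=> t /=; rewrite [leRHS]ger0_norm ?sqrtr_ge0// le_norm_Dk.
by rewrite !rVE; apply: H => //; exact: lorentz_norm_fin_ge0.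
Qed.
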